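(* Consider the impulsive Lasota-Wazewska model $$N'(t)+a(t)N(t)=\sum_{i=1}^n b_i(t)e^{-\beta_i(t)N(t-\tau_i(t))}\quad(0\le t\ne t_k),\qquad \Delta N(t_k):=N(t_k^+)-N(t_k)=I_k(N(t_k))\quad(k=1,2,\dots),\tag{L}$$ in the setting described in the context. Assume that there exist constants $a_1,\dots,a_p$ and $b_1,\dots,b_p$ with $b_k>-1$ such that $$b_k\le\frac{I_k(x)-I_k(y)}{x-y}\le a_k,\qquad x,y\ge0,\ x\ne y,\ k=1,\dots,p,$$ and that $\prod_{k=1}^p(1+a_k)\le1$. Assume also that there is a positive $\omega$-periodic solution $N^*(t)$ of (L). If there is $T>\bar\tau$ such that $\alpha_1\alpha_2<1$ with $$\alpha_1=\sup_{t\ge T}\int_{t-\tau(t)}^t\sum_{i=1}^n\beta_i(s)b_i(s)e^{-\beta_i(s)N^*(s-\tau_i(s))}B_i(s)e^{-\int_s^ta(u)\,du}\,ds,$$ $$\alpha_2=\sup_{t\ge T}\int_{t-\tau(t)}^t\sum_{i=1}^n\beta_i(s)b_i(s)B_i(s)e^{-\int_s^ta(u)\,du}\,ds,$$ where $B_i(t)=\max_{\theta\in[-\tau_i(t),0]}\Big(\prod_{k:\,t+\theta\le t_k<t}(1+b_k)^{-1}\Big)$, then $N^*(t)$ is globally asymptotically stable, in the sense that it is stable and any positive solution $N(t)$ of (L) satisfies $\lim_{t\to\infty}(N(t)-N^*(t))=0$.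
   Context: Setting. $\omega>0$ and $n,p$ are positive integers. The functions $a,b_i,\beta_i,\tau_i:\mathbb{R}\to(0,\infty)$, $1\le i\le n$, are continuous, positive and $\omega$-periodic; $\tau(t)=\max_{1\le i\le n}\tau_i(t)$ and $\bar\tau=\max_{t}\tau(t)$; each map $t\mapsto t-\tau_i(t)$ may be assumed non-decreasing. $0<t_1<t_2<\cdots$, $t_k\to\infty$; $I_k:[0,\infty)\to\mathbb{R}$ are continuous with $u+I_k(u)>0$ for $u>0$; $t_{k+p}=t_k+\omega$ and $I_{k+p}(u)=I_k(u)$ for $k\in\mathbb{N}$, $u>0$; exactly $p$ impulse instants $t_1,\dots,t_p$ lie in $[0,\omega]$. The constants are extended by $a_{k+p}=a_k$, $b_{k+p}=b_k$. An empty product equals 1. Solutions are left continuous and $N'(t)$ is the left-hand derivative. Positive solutions of (L) are the solutions with initial condition $N(\theta)=\phi(\theta)$ on $[-\bar\tau,0]$, where $\phi:[-\bar\tau,0]\to[0,\infty)$ is continuous with $\phi(0)>0$. $N^*$ is stable means that the zero solution of the equation satisfied by $x(t)=N(t)-N^*(t)$ is stable: for every $\varepsilon>0$ and $t_0\ge0$ there is $\delta>0$ such that, for every solution $N$ of (L) with $N(t_0+\theta)=\psi(\theta)$ for $\theta\in[-\bar\tau,0]$, where $\psi$ is piecewise continuous and left continuous on $(-\bar\tau,0]$, $\psi\ge0$, $\psi(0)>0$, the inequality $\sup_{\theta\in[-\bar\tau,0]}|\psi(\theta)-N^*(t_0+\theta)|<\delta$ implies $|N(t)-N^*(t)|<\varepsilon$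 for all $t\ge t_0$. *)

(* Defs.v *)
From HB Require Import structures.
From mathcomp Require Import all_boot all_order all_algebra.
From mathcomp Require Import all_classical all_reals all_analysis.
Set Implicit Arguments.
Unset Strict Implicit.
Unset Printing Implicit Defensive.
Import Order.TTheory GRing.Theory Num.Theory.
Import numFieldNormedType.Exports.
Local Open Scope classical_set_scope.
Local Open Scope ring_scope.

(* Conventions. The functions b_i, beta_i, tau_i (1 <= i <= n) are indexed by  *)
(* 'I_n, and the impulse data are indexed from 0: tk k, Imp k, ak k, bk k      *)
(* stand for t_{k+1}, I_{k+1}, a_{k+1}, b_{k+1}. Functions defined on an       *)
(* interval only are total functions constrained on that interval.             *)

Definition pos_periodic_cont (R : realType) (omega : R) (f : R -> R) : Prop :=
  [/\ continuous f, forall s, 0 < f s & forall s, f (s + omega) = f s].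

(* The base point 0 of the iterated maximum is harmless: n > 0 and tau_i > 0.  *)
Definition tau_max (R : realType) (n : nat) (tau : 'I_n -> R -> R) (s : R) : R :=
  \big[Num.max/0]_(i < n) tau i s.

Definition tau_bar (R : realType) (n : nat) (tau : 'I_n -> R -> R) : R :=
  sup (range (tau_max tau)).

Definition is_left_derive (R : realType) (f : R -> R) (x l : R) : Prop :=
  (f (x + h) - f x) / h @[h --> 0^'-] --> l.

(* N solves (L) from time t0 on; only the values of N on [t0 - tau_bar, oo)    *)
(* matter. At t0 itself the left-hand derivative would involve the initial     *)
(* function only, so the differential equation is imposed for s > t0. An       *)
(* impulse at t0 does act, since N t0 is the value before the jump.            *)
Definition solution (R : realType) (n : nat) (a : R -> R)
    (b beta tau : 'I_n -> R -> R) (tk : nat -> R) (Imp : nat -> R -> R)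
    (t0 : R) (N : R -> R) : Prop :=
  [/\ (forall s, t0 < s -> N x @[x --> s^'-] --> N s),
      (forall s, t0 <= s -> (forall k, s <> tk k) ->
         N x @[x --> s^'+] --> N s),
      (forall s, t0 < s -> (forall k, s <> tk k) ->
         exists2 dN, is_left_derive N s dN &
           dN + a s * N s
           = \sum_(i < n) b i s * expR (- beta i s * N (s - tau i s))) &
      (forall k, t0 <= tk k ->
         exists2 Nplus, N x @[x --> (tk k)^'+] --> Nplus &
           Nplus - N (tk k) = Imp k (N (tk k)))].

Definition positive_solution (R : realType) (n : nat) (a : R -> R)
    (b beta tau : 'I_n -> R -> R) (tk : nat -> R) (Imp : nat -> R -> R)
    (N : R -> R) : Prop :=
  [/\ solution a b beta tau tk Imp 0 N,
      {within `[- tau_bar tau, 0], continuous N},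
      forall th, - tau_bar tau <= th <= 0 -> 0 <= N th &
      0 < N 0].

(* N* lives on [- tau_bar, oo).                                                *)
Definition positive_periodic_solution (R : realType) (n : nat) (omega : R)
    (a : R -> R) (b beta tau : 'I_n -> R -> R) (tk : nat -> R)
    (Imp : nat -> R -> R) (Nst : R -> R) : Prop :=
  [/\ solution a b beta tau tk Imp 0 Nst,
      forall s, - tau_bar tau <= s -> 0 < Nst s &
      forall s, - tau_bar tau <= s -> Nst (s + omega) = Nst s].

(* Finitely many discontinuities in [c, d], with finite one-sided limits.      *)
Definition piecewise_continuous (R : realType) (c d : R) (f : R -> R) : Prop :=
  [/\ exists D : seq R, forall x, c < x < d -> x \notin D ->
        {for x, continuous f},
      forall x, c <= x < d -> cvg (f y @[y --> x^'+]) &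
      forall x, c < x <= d -> cvg (f y @[y --> x^'-])].

Definition admissible_history (R : realType) (r : R) (psi : R -> R) : Prop :=
  [/\ piecewise_continuous (- r) 0 psi,
      forall th, - r < th <= 0 -> psi x @[x --> th^'-] --> psi th,
      forall th, - r <= th <= 0 -> 0 <= psi th &
      0 < psi 0].

Definition stable (R : realType) (n : nat) (a : R -> R)
    (b beta tau : 'I_n -> R -> R) (tk : nat -> R) (Imp : nat -> R -> R)
    (Nst : R -> R) : Prop :=
  forall eps t0 : R, 0 < eps -> 0 <= t0 ->
  exists2 delta : R, 0 < delta &
    forall N : R -> R,
      solution a b beta tau tk Imp t0 N ->
      admissible_history (tau_bar tau) (fun th => N (t0 + th)) ->
      (ereal_sup [set (`|N (t0 + th) - Nst (t0 + th)|%R)%:E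
                 | th in `[(- tau_bar tau)%R, 0%R]] < delta%:E)%E ->
      forall s, t0 <= s -> `|N s - Nst s| < eps.

Definition globally_asymptotically_stable (R : realType) (n : nat) (a : R -> R)
    (b beta tau : 'I_n -> R -> R) (tk : nat -> R) (Imp : nat -> R -> R)
    (Nst : R -> R) : Prop :=
  stable a b beta tau tk Imp Nst /\
  forall N : R -> R, positive_solution a b beta tau tk Imp N ->
    N s - Nst s @[s --> +oo] --> 0.

(* The index set of the product is finite because tk tends to +oo, so only     *)
(* finitely many products occur and the supremum is a maximum.                 *)
Definition Bmax (R : realType) (tk bk : nat -> R) (taui : R -> R) (s : R) : R :=
  sup [set \big[*%R/1]_(k \in [set k | s + th <= tk k < s]) (1 + bk k)^-1
      | th in `[- taui s, 0]].

Definition alpha1 (R : realType) (n : nat) (a : R -> R)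
    (b beta tau : 'I_n -> R -> R) (tk bk : nat -> R) (Nst : R -> R) (T : R)
    : \bar R :=
  ereal_sup [set (\int[@lebesgue_measure R]_(s in `[(t - tau_max tau t)%R, t])
      ((\sum_(i < n) beta i s * b i s * expR (- beta i s * Nst (s - tau i s))
                     * Bmax tk bk (tau i) s
                     * expR (- \int[@lebesgue_measure R]_(u in `[s, t]) a u))%R
        )%:E)%E
    | t in [set t | T <= t]].

Definition alpha2 (R : realType) (n : nat) (a : R -> R)
    (b beta tau : 'I_n -> R -> R) (tk bk : nat -> R) (T : R) : \bar R :=
  ereal_sup [set (\int[@lebesgue_measure R]_(s in `[(t - tau_max tau t)%R, t])
      ((\sum_(i < n) beta i s * b i s * Bmax tk bk (tau i) s
                     * expR (- \int[@lebesgue_measure R]_(u in `[s, t]) a u))%R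
        )%:E)%E
    | t in [set t | T <= t]].

(* Main.v *)
Require Import Defs.
From HB Require Import structures.
From mathcomp Require Import all_boot all_order all_algebra.
From mathcomp Require Import all_classical all_reals all_analysis.
From mathcomp Require Import measurable_realfun.
From mathcomp Require Import lra ring.
Set Implicit Arguments.
Unset Strict Implicit.
Unset Printing Implicit Defensive.
Import Order.TTheory GRing.Theory Num.Theory.
Import numFieldNormedType.Exports.
Local Open Scope classical_set_scope.
Local Open Scope ring_scope.

(** Let [x] be the difference of a solution [N] and the periodic solution.
At an impulse, [x] is multiplied by a ratio which the slope hypothesis places
between [1 + bk k] and [1 + ak k].  Dividing [x] by the product [P] of the
ratios met so far gives a continuous function [y] ([unjumped]).  As the product
of the [1 + ak k] over a period is at most 1, [P] is bounded, so it suffices to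
estimate [y]; and [P (s - tau_i s) / P s] is a product of inverse ratios, which
is at most [B_i s].

Let [A] be a primitive of [a].  Where the positive part of the delayed [x]
acts, the tangent of the exponential at the periodic solution bounds the
right-hand side; where the negative part acts, the bound 1 on the exponential
of a negative number does.  So the left derivative [D] of [y * expR A] lies, at
time [s], between
  [- expR (A s) * sum_i down_i s * y^+ (s - tau_i s)]  and
  [expR (A s) * sum_i up_i s * y^- (s - tau_i s)]
([unjumped_delay_ineq]), where [down] and [up] are the coefficients in the
integrands of alpha1 and alpha2.

From here on only this two-sided inequality is used.  Suppose [y t > 0].  If
[y] has been positive for longer than the largest delay, then [D <= 0] and [y]
decays at least as fast as [expR (- A)].  Otherwise let [xi] be the last zero
of [y] before [t].  Once all delayed arguments have passed [xi], [y * expR A]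
no longer increases, so the whole rise from 0 takes place inside one window
[[c - tau c, c]], and it is at most alpha2 times a bound of [y^-] ([yorke]).
Exchanging [y] and [- y], the negative part is at most alpha1 times a bound of
[y^+].  Choosing a weight [w] with alpha2 < w < 1 / alpha1, the quantity
[max (y / w) (- y)] has every bound improved by a factor [q < 1] over each such
step, up to a term that decays exponentially.  Iterating this contraction gives a bound by
the initial size ([contraction_bounded]) and convergence to 0
([contraction_vanishes]).  On the initial stretch, where the windows are not
controlled by alpha1 and alpha2, a Gronwall estimate gives stability
([gronwall]).

The coefficients contain [B_i], a supremum of products whose measurability is
not evident.  The integrals of alpha1 and alpha2 are therefore used as suprema
of integrals of simple functions lying below the integrand, hence they are
monotone ([le_lower_integral]); the left derivative
[D] is a pointwise limit of continuous difference quotients, so it has a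
genuine integral, which is the increment of the function
([left_derive_le_integral]). *)

(** * Left derivatives *)

Lemma near_left_shift (R : realType) (x : R) (P : R -> Prop) :
  (\forall u \near x^'-, P u) -> \forall h \near 0^'-, P (x + h).
Proof.
move=> [e /= e0 He]; exists e => //= h /= hb h0; apply: He => /=.
  by move: hb; rewrite sub0r normrN opprD addrA subrr sub0r normrN.
by rewrite gtrDl.
Qed.

Lemma cvg_left_shift (R : realType) (f : R -> R) (x l : R) :
  f u @[u --> x^'-] --> l -> f (x + h) @[h --> 0^'-] --> l.
Proof. by move=> fx A /fx; apply: near_left_shift. Qed.

Lemma is_derive_left_derive (R : realType) (f : R -> R) (x l : R) :
  is_derive x 1 f l -> is_left_derive f x l.
Proof.
move=> [/cvg_ex[/= l' fl] <-]; rewrite /is_left_derive.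
have -> : 'D_1 f x = l' by apply/cvg_lim.
have h0 : 0^'- `=>` (0 : R)^'.
  move=> A [e /= e0 He]; exists e => //= y ye y0; apply: He => //=.
  by rewrite lt_eqF.
apply: cvg_trans fl.
apply: cvg_trans; last by apply: cvg_app; exact: h0.
apply: near_eq_cvg; near=> h => /=.
by rewrite /GRing.scale /= mulr1 mulrC (addrC h).
Unshelve. all: by end_near. Qed.

Lemma left_derive_eq_near (R : realType) (f g : R -> R) (x l : R) :
  (\forall u \near x^'-, f u = g u) -> f x = g x ->
  is_left_derive f x l -> is_left_derive g x l.
Proof.
move=> /near_left_shift fg fgx; apply: cvg_trans.
apply: near_eq_cvg; near=> h; rewrite fgx; congr ((_ - _) / _).
by near: h; exact: fg.
Unshelve. all: by end_near. Qed.

Lemma left_deriveD (R : realType) (f g : R -> R) (x l m : R) :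
  is_left_derive f x l -> is_left_derive g x m ->
  is_left_derive (fun u => f u + g u) x (l + m).
Proof.
move=> fl gm; rewrite /is_left_derive.
rewrite (_ : (fun h => _) = (fun h => (f (x + h) - f x) / h + (g (x + h) - g x) / h)).
  exact: cvgD.
by apply/funext => h; rewrite -mulrDl; congr (_ / _); ring.
Qed.

Lemma left_deriveZ (R : realType) (f : R -> R) (x l c : R) :
  is_left_derive f x l -> is_left_derive (fun u => c * f u) x (c * l).
Proof.
move=> fl; rewrite /is_left_derive.
rewrite (_ : (fun h => _) = (fun h => c * ((f (x + h) - f x) / h))).
  exact: cvgMr.
by apply/funext => h; rewrite mulrA; congr (_ / _); ring.
Qed.

Lemma left_deriveM (R : realType) (f g : R -> R) (x l m : R) :
  is_left_derive f x l -> is_derive x 1 g m ->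
  is_left_derive (fun u => f u * g u) x (l * g x + f x * m).
Proof.
move=> fl gm.
have gc : g u @[u --> x^'-] --> g x.
  apply: cvg_within_filter; apply/differentiable_continuous.
  by apply/derivable1_diffP; case: gm.
have gl := is_derive_left_derive gm.
rewrite /is_left_derive.
rewrite (_ : (fun h => _) = (fun h => (f (x + h) - f x) / h * g (x + h)
    + f x * ((g (x + h) - g x) / h))).
  apply: cvgD; [apply: cvgM => //; exact: cvg_left_shift|exact: cvgMr].
by apply/funext => h; ring.
Qed.

(** At a minimum over [[c, u]] other than [c] the left derivative cannot be
positive, since the values just to the left of it would be smaller.  So for
[u < d] the minimum is attained at [c]; the end point [d], where no derivative
is assumed, is reached by continuity. *)
Lemma left_derive_ndecr_strict (R : realType) (g : R -> R) (c d : R) :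
  c <= d -> {within `[c, d], continuous g} ->
  (forall s, c < s < d -> exists2 l, is_left_derive g s l & 0 < l) ->
  g c <= g d.
Proof.
move=> + gc gl; rewrite le_eqVlt => /predU1P[->//|cd].
have main u : c <= u < d -> g c <= g u.
  move=> /andP[cu ud].
  have gcu : {within `[c, u], continuous g}.
    by apply: continuous_subspaceW gc; apply: subset_itvl; rewrite bnd_simp ltW.
  have [m mcu mmin] := EVT_min cu gcu.
  case: (eqVneq m c) => [mc|mc].
    by rewrite -[X in g X <= _]mc; apply: mmin; rewrite in_itv/= cu lexx.
  move: mcu; rewrite in_itv/= => /andP[cm mu].
  have {mc}cm : c < m by rewrite lt_neqAle eq_sym mc.
  have [|l gml l0] := gl m; first by rewrite cm (le_lt_trans mu).
  exfalso.
  have h1 := cvgr_gt _ gml 0 l0.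
  have h2 : \forall h \near (0:R)^'-, c <= m + h.
    apply: (@near_left_shift _ _ (fun v => c <= v)); near=> w.
    by apply/ltW; near: w; exact: nbhs_left_gt.
  near (0%R:R)^'- => h.
  have hlt : h < 0 by near: h; exact: nbhs_left_lt.
  have : g m <= g (m + h).
    apply: mmin; rewrite in_itv/=; apply/andP; split.
      by near: h; exact: h2.
    by rewrite (le_trans _ mu)// gerDl ltW.
  have : 0 < (g (m + h) - g m) / h by near: h; exact: h1.
  by rewrite nmulr_lgt0 ?invr_lt0// subr_lt0 => /lt_geF ->.
have [_ _ gd] := (continuous_within_itvP g cd).1 gc.
apply: (cvgr_to_ge gd) => //.
near=> u; apply: main; apply/andP; split.
  by apply/ltW; near: u; exact: nbhs_left_gt.
by near: u; exact: nbhs_left_lt.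
Unshelve. all: by end_near. Qed.

(** Adding [k * s] for a small [k > 0] makes the left derivative positive. *)
Lemma left_derive_ndecr_eps (R : realType) (g : R -> R) (c d : R) :
  c <= d -> {within `[c, d], continuous g} ->
  (forall s, c < s < d -> exists2 l, is_left_derive g s l & 0 <= l) ->
  g c <= g d.
Proof.
move=> cd gc gl; apply/ler_addgt0Pr => e e0.
have dc : 0 < d - c + 1 by rewrite ltr_wpDl// subr_ge0.
pose k := e / (d - c + 1).
have k0 : 0 < k by rewrite divr_gt0.
have kE : k * (d - c + 1) = e by rewrite mulfVK ?gt_eqF.
have : g c + k * c <= g d + k * d.
  apply: (@left_derive_ndecr_strict _ (fun s => g s + k * s)) => //.
    apply: (@within_continuousD _ _ _ _ g (fun s => k * s)) => //.
    by apply: continuous_subspaceT => x; apply: cvgMr; exact: cvg_id.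
  move=> s /gl[l gsl l0]; exists (l + k * 1); last by rewrite mulr1 ltr_wpDl.
  apply: left_deriveD => //; apply: left_deriveZ.
  exact: is_derive_left_derive.
move: kE; rewrite mulrDr mulrBr mulr1; lra.
Qed.

(** The mean value inequality for left derivatives.  Exceptional points are
allowed because the impulse times carry no differential equation. *)
Lemma left_derive_ndecr (R : realType) (E : seq R) (g : R -> R) (c d : R) :
  c <= d -> {within `[c, d], continuous g} ->
  (forall s, c < s < d -> s \notin E ->
     exists2 l, is_left_derive g s l & 0 <= l) ->
  g c <= g d.
Proof.
elim: E c d => [|e E IH] c d cd gc gl.
  by apply: left_derive_ndecr_eps => // s /gl; apply.
have [/andP[ce ed]|ecd] := boolP (c < e < d); last first.
  apply: IH => // s scd sE; apply: gl => //; rewrite in_cons negb_or sE andbT.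
  by apply: contraNneq ecd => <-.
apply: (@le_trans _ _ (g e)); apply: IH; rewrite ?(ltW ce) ?(ltW ed)//.
- by apply: continuous_subspaceW gc; apply: subset_itvl; rewrite bnd_simp ltW.
- move=> s /andP[cs se] sE; apply: gl; first by rewrite cs (lt_trans se).
  by rewrite in_cons negb_or sE andbT lt_eqF.
- by apply: continuous_subspaceW gc; apply: subset_itvr; rewrite bnd_simp ltW.
- move=> s /andP[es sd] sE; apply: gl; first by rewrite sd (lt_trans ce).
  by rewrite in_cons negb_or sE andbT gt_eqF.
Qed.

Lemma left_derive_le_linear (R : realType) (E : seq R) (g : R -> R) (c d K : R) :
  c <= d -> {within `[c, d], continuous g} ->
  (forall s, c < s < d -> s \notin E ->
     exists2 l, is_left_derive g s l & l <= K) ->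
  g d - g c <= K * (d - c).
Proof.
move=> cd gc gl.
have : K * c + -1 * g c <= K * d + -1 * g d.
  apply: (@left_derive_ndecr _ E (fun s => K * s + -1 * g s)) => //.
    apply: (@within_continuousD _ _ _ _ (fun s => K * s) (fun s => -1 * g s)) => //.
    by apply: continuous_subspaceT => x; apply: cvgMr; exact: cvg_id.
    by move=> x; apply: cvgMr; exact: gc.
  move=> s scd /(gl _ scd)[l gsl lK]; exists (K * 1 + -1 * l); last by lra.
  apply: left_deriveD; apply: left_deriveZ => //.
  exact: is_derive_left_derive.
by rewrite mulrBr; lra.
Qed.

Lemma left_derive_lipschitz (R : realType) (E : seq R) (g : R -> R) (c d K : R) :
  c <= d -> {within `[c, d], continuous g} ->
  (forall s, c < s < d -> s \notin E ->
     exists2 l, is_left_derive g s l & `|l| <= K) ->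
  `|g d - g c| <= K * (d - c).
Proof.
move=> cd gc gl; rewrite ler_norml; apply/andP; split; last first.
  apply: (@left_derive_le_linear _ E) => // s scd /(gl _ scd)[l gsl].
  by rewrite ler_norml => /andP[_ lK]; exists l.
rewrite lerNl.
have -> : - (g d - g c) = (-1 * g d) - (-1 * g c) by lra.
apply: (@left_derive_le_linear _ E (fun s => -1 * g s)) => //.
  by move=> x; apply: cvgMr; exact: gc.
move=> s scd /(gl _ scd)[l gsl].
rewrite ler_norml => /andP[lK _]; exists (-1 * l); last by lra.
exact: left_deriveZ.
Qed.

(** The integral of a nonnegative function is a supremum over the simple
functions below it, whether or not the function is measurable; so it is
monotone in the integrand and in the domain without measurability. *)
Lemma le_lower_integral d (T : measurableType d) (R : realType)
    (mu : {measure set T -> \bar R}) (D1 D2 : set T) (f1 f2 : T -> \bar R) :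
  D1 `<=` D2 -> (forall x, D2 x -> (0 <= f2 x)%E) ->
  (forall x, D1 x -> (0 <= f1 x <= f2 x)%E) ->
  (\int[mu]_(x in D1) f1 x <= \int[mu]_(x in D2) f2 x)%E.
Proof.
move=> D12 f20 f12; rewrite (integral_mkcond D1) (integral_mkcond D2).
rewrite !ge0_integralTE; first last.
- by move=> x; apply: erestrict_ge0 => y /f12/andP[].
- exact: erestrict_ge0.
apply: ereal_sup_le => _ [h /= hf <-]; exists h => //= x; apply: (le_trans (hf x)).
rewrite !patchE; case: ifPn => [/set_mem D1x|_].
  by rewrite mem_set; [case/andP: (f12 _ D1x)|exact: D12].
by case: ifPn => // /set_mem/f20.
Qed.

(** * Increments as integrals of left derivatives *)

Lemma cvg_natSinv_left0 (R : realType) :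
  - (n.+1%:R^-1 : R) @[n --> \oo] --> 0^'-.
Proof.
move=> A [e /= e0 He].
change (\forall n \near \oo, A (- (n.+1%:R^-1))); near=> n; apply: He => /=.
  rewrite sub0r normrN normrN ger0_norm//; near: n.
  exact: (near_infty_natSinv_lt (PosNum e0)).
by rewrite oppr_lt0.
Unshelve. all: by end_near. Qed.

Lemma left_derive_seq (R : realType) (f : R -> R) (x l : R) :
  is_left_derive f x l ->
  (f x - f (x - n.+1%:R^-1)) * n.+1%:R @[n --> \oo] --> l.
Proof.
move=> fl; have := cvg_comp _ _ (@cvg_natSinv_left0 R) fl.
apply: cvg_trans; apply: near_eq_cvg; near=> n => /=.
by rewrite invrN invrK mulrN -mulNr opprB.
Unshelve. all: by end_near. Qed.

(** Composing with [clamp c d] extends a function continuous on [[c, d]] to a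
function continuous on the line, constant on both sides. *)
Definition clamp (R : realType) (c d s : R) : R := Num.max c (Num.min d s).

Lemma continuous_clamp (R : realType) (g : R -> R) (c d : R) : c <= d ->
  {within `[c, d], continuous g} -> continuous (fun s => g (clamp c d s)).
Proof.
move=> cd /subspace_continuousP gc s.
have clampC : continuous (clamp c d : R -> R).
  move=> u; apply: (@continuous_max R R (fun=> c) (fun v => Num.min d v)).
    exact: cvg_cst.
  apply: (@continuous_min R R (fun=> d) id); [exact: cvg_cst|exact: cvg_id].
have clampI u : `[c, d]%classic (clamp c d u).
  by rewrite /= in_itv/= /clamp le_max lexx ge_max cd ge_min lexx.
apply: (cvg_comp (clamp c d) g _ (gc _ (clampI s))) => A.
rewrite /within /= => H; apply: (@filterS _ (nbhs s) _ _ _ _ (clampC s _ H)) => u; apply.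
exact: clampI.
Qed.

Lemma clamp_id (R : realType) (c d s : R) : c <= s <= d -> clamp c d s = s.
Proof. by move=> /andP[cs sd]; rewrite /clamp min_r// max_r. Qed.

(** The base point [l] of the primitive is a free parameter because the
fundamental theorem of calculus only gives the derivative to its right. *)
Lemma exists_primitive (R : realType) (f : R -> R) (l : R) : continuous f ->
  exists F : R -> R, forall x, l < x -> is_derive x 1 F (f x).
Proof.
move=> fc; exists (fun x => \int[@lebesgue_measure R]_(t in `[l, x]) f t).
move=> x lx; have xx1 : x < x + 1 by rewrite ltrDl.
have fi : (@lebesgue_measure R).-integrable `[l, x + 1] (EFin \o f).
  apply: continuous_compact_integrable; first exact: segment_compact.
  exact: continuous_subspaceT.
have [dF F'] := @continuous_FTC1_closed R f l x (x + 1) xx1 fi lx (fc x).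
by split => //; rewrite -derive1E.
Qed.

Lemma integral_primitive (R : realType) (f F : R -> R) (l c d : R) :
  continuous f -> (forall x, l < x -> is_derive x 1 F (f x)) ->
  l < c -> c <= d ->
  (\int[@lebesgue_measure R]_(t in `[c, d]) (f t)%:E = (F d - F c)%:E)%E.
Proof.
move=> fc Ff lc; rewrite le_eqVlt => /predU1P[<-|cd].
  by rewrite set_itv1 integral_set1 subrr.
have FC x : l < x -> F @ x --> F x.
  move=> lx; apply/differentiable_continuous/derivable1_diffP.
  by case: (Ff x lx).
rewrite (@continuous_FTC2 _ f F) ?EFinB//.
- exact: continuous_subspaceT.
- split.
  + move=> x; rewrite in_itv/= => /andP[cx _].
    by case: (Ff x (lt_trans lc cx)).
  + apply: cvg_within_filter; exact: FC.
  + apply: cvg_within_filter; apply: FC; exact: lt_trans cd.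
- move=> x; rewrite in_itv/= => /andP[cx _].
  by rewrite derive1E; case: (Ff x (lt_trans lc cx)).
Qed.

Lemma clamp_lip (R : realType) (c d t s : R) : c <= d -> t <= s ->
  clamp c d t <= clamp c d s /\ clamp c d s - clamp c d t <= s - t.
Proof.
rewrite /clamp => cd ts.
case: (leP d s) => ds; case: (leP d t) => dt; rewrite ?(max_r cd).
- by split; lra.
- by case: (leP c t) => ct; split; lra.
- by exfalso; lra.
- by case: (leP c t) => ct; case: (leP c s) => cs; split; lra.
Qed.

(** The increment of [g] is the limit of the integrals of its difference
quotients, by writing those as difference quotients of a primitive of [g].  The
quotients are bounded by [K] because [g] is [K]-Lipschitz, so by dominated
convergence the limit is the integral of their pointwise limit, which is [D]
outside a finite set.  The comparison with [m] then goes through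
[le_lower_integral], as [m] will contain the suprema [Bmax]. *)
Lemma left_derive_le_integral (R : realType) (E : seq R) (g D m : R -> R)
    (c d K : R) :
  0 <= K -> c < d -> {within `[c, d], continuous g} ->
  (forall s, c < s < d -> s \notin E -> is_left_derive g s (D s)) ->
  (forall s, c < s < d -> s \notin E -> `|D s| <= K) ->
  (forall s, c <= s <= d -> 0 <= m s) ->
  (forall s, c < s < d -> s \notin E -> D s <= m s) ->
  ((g d - g c)%:E <= \int[@lebesgue_measure R]_(s in `[c, d]) (m s)%:E)%E.
Proof.
move=> K0 cd gc gD DK m0 Dm; have cd' := ltW cd.
pose mu := @lebesgue_measure R.
pose G s := g (clamp c d s).
have GC : continuous G by exact: continuous_clamp.
have GE s : c <= s <= d -> G s = g s by move=> scd; rewrite /G clamp_id.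
have [F FG] := exists_primitive (c - 2) GC.
(* The step [h n] is at most 1, so [F] is differentiable at [x - h n] for all
   [x > c - 1]. *)
pose h n : R := n.+1%:R^-1.
have h0 n : 0 < h n by rewrite invr_gt0.
have h1 n : h n <= 1 by rewrite invf_le1// ler1n.
pose q n s := (G s - G (s - h n)) * n.+1%:R.
have hE n : n.+1%:R = (h n)^-1 :> R by rewrite /h invrK.
have lip s t : t <= s -> `|G s - G t| <= K * (s - t).
  move=> ts; have [cts stl] := clamp_lip cd' ts.
  have clampI u : c <= clamp c d u <= d.
    by rewrite /clamp le_max lexx ge_max cd' ge_min lexx.
  apply: le_trans (_ : K * (clamp c d s - clamp c d t) <= _); last exact: ler_wpM2l.
  rewrite /G; apply: (@left_derive_lipschitz _ E g) => //.
    apply: continuous_subspaceW gc; apply: subset_itvScc.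
      by have /andP[] := clampI t.
    by have /andP[] := clampI s.
  move=> u /andP[tu us] uE; have ucd : c < u < d.
    have /andP[ct _] := clampI t; have /andP[_ sd] := clampI s.
    by rewrite (le_lt_trans ct tu) (lt_le_trans us sd).
  by exists (D u); [exact: gD|exact: DK].
have qK n s : `|q n s| <= K.
  rewrite /q normrM (ger0_norm (ler0n _ _)) hE ler_pdivrMr//.
  apply: le_trans (lip _ _ _) _; first by rewrite gerBl ltW.
  by rewrite opprB addrC subrK.
have qC n : continuous (q n).
  move=> s; apply: cvgMl; apply: cvgB; first exact: GC.
  apply: (cvg_comp (fun u => u - h n) G _ (GC (s - h n))).
  by apply: cvgB; [exact: cvg_id|exact: cvg_cst].
pose N : set R := [set` c :: d :: E].
have N0 : mu N = 0%E.
  by apply: countable_lebesgue_measure0; apply: finite_set_countable; exact: finite_seq.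
have mN : measurable (N : set (measurableTypeR R)) by apply: countable_measurable => //; apply: finite_set_countable; exact: finite_seq.
(* The upper limit agrees with [D] off [N] and is measurable everywhere. *)
pose f s := limn_esup (fun n => (q n s)%:E).
have qD s : c < s < d -> s \notin E -> q n s @[n --> \oo] --> D s.
  move=> /andP[cs sd] sE.
  have : is_left_derive G s (D s).
    apply: left_derive_eq_near; last by apply: gD; rewrite ?cs.
    near=> u; rewrite GE//; apply/andP; split; apply/ltW.
      by near: u; exact: nbhs_left_gt.
    by apply: (@lt_trans _ _ s) => //; near: u; exact: nbhs_left_lt.
    by rewrite GE// !ltW.
  exact: left_derive_seq.
have qE s : c < s < d -> s \notin E -> (q n s)%:E @[n --> \oo] --> (D s)%:E.
  move=> scd sE; apply: cvg_EFin; first exact: nearW.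
  exact: qD.
have fD s : c < s < d -> s \notin E -> f s = (D s)%:E.
  move=> scd sE; have H := qE s scd sE.
  have cH : cvgn (fun n => (q n s)%:E) by apply/cvg_ex; exists (D s)%:E.
  by rewrite /f (is_cvg_limn_esupE cH); apply/cvg_lim.
have intq n : (\int[mu]_(s in `[c, d]) (q n s)%:E)%E =
    ((F d - F (d - h n)) * n.+1%:R - (F c - F (c - h n)) * n.+1%:R)%:E.
  pose Q s := (F s - F (s - h n)) * n.+1%:R.
  suff QD x : c - 1 < x -> is_derive x 1 Q (q n x).
    by apply: (integral_primitive (qC n) QD _ cd'); rewrite gtrBl.
  move=> cx; rewrite /Q /q.
  have i1 : is_derive x 1 F (G x) by apply: FG; move: cx; lra.
  have i2 : is_derive x 1 (fun u => F (u - h n)) (G (x - h n)).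
    have i3 : is_derive (x - h n) 1 F (G (x - h n)).
      by apply: FG; move: cx (h1 n); lra.
    have i4 : is_derive x 1 (fun u => u - h n) 1.
      by apply: is_derive_eq; rewrite subr0.
    by have := @is_derive1_comp _ F (fun u => u - h n) x _ _ i3 i4; rewrite mulr1.
  rewrite (_ : (fun _ => _) = (fun u => n.+1%:R *: (F u - F (u - h n)))).
    by apply: is_derive_eq; rewrite /GRing.scale /= mulrC.
  by apply/funext => u; rewrite /GRing.scale/= mulrC.
have cvgint : (\int[mu]_(s in `[c, d]) (q n s)%:E)%E @[n --> \oo]
    --> (g d - g c)%:E.
  rewrite -(GE c) ?lexx// -(GE d) ?lexx ?andbT//.
  rewrite (_ : (fun n => _) = (fun n => ((F d - F (d - h n)) * n.+1%:R -
     (F c - F (c - h n)) * n.+1%:R)%:E)); last exact/funext.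
  apply: cvg_EFin => //=; first exact: nearW.
  apply: cvgB; apply: left_derive_seq; apply: is_derive_left_derive; apply: FG.
    by rewrite (lt_trans _ cd)// gtrBl.
  by rewrite gtrBl.
have mq0 n : measurable_fun (`[c, d]%classic : set R) (q n).
  apply: subspace_continuous_measurable_fun => //; exact: continuous_subspaceT.
have mq n := (measurable_EFinP _ _).2 (mq0 n).
have mf := measurable_fun_limn_esup mq.
have gN s : `[c, d]%classic s -> ~ N s -> c < s < d /\ s \notin E.
  rewrite /= in_itv/= => /andP[cs sd] /negP; rewrite !inE !negb_or.
  by move=> /and3P[sc sd' sE]; rewrite !lt_neqAle cs sd sd' eq_sym sc.
have [fint _ fcvg] : [/\ mu.-integrable `[c, d] f,
     ([sequence \int[mu]_(x in `[c, d]) (`|(q n x)%:E - f x|)]_n @ \oo --> 0)%E &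
     ([sequence \int[mu]_(x in `[c, d]) ((q n x)%:E)]_n @ \oo
        --> \int[mu]_(x in `[c, d]) (f x))%E].
  apply: (@dominated_convergence _ _ _ _ _ _ _ _ (cst K%:E)) => //.
  - exists N; split => // s /= Hs; apply: contrapT => Ns; apply: Hs => scd.
    have [h2 sE] := gN _ scd Ns.
    by rewrite fD//; exact: qE.
  - apply: (@continuous_compact_integrable R (cst K)).
      exact: segment_compact.
    exact: cst_continuous.
  - by apply: aeW => s n _; rewrite abse_EFin lee_fin.
have -> : (g d - g c)%:E = (\int[mu]_(x in `[c, d]) (f x))%E.
  exact: (cvg_unique _ cvgint fcvg).
rewrite (negligible_integral mN _ fint N0)//.
have mD : measurable (`[c, d]%classic `\` N : set (measurableTypeR R)) by apply: measurableD.
have fint' : mu.-integrable (`[c, d] `\` N) f.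
  by apply: integrableS fint => // x [].
apply: (@le_trans _ _ (\int[mu]_(x in `[c, d] `\` N) (f^\+ x))%E).
  apply: le_integral => //; first exact: integrable_funepos.
  by move=> x _; rewrite funeposE le_max lexx.
apply: le_lower_integral; first by move=> x [].
  by move=> x; rewrite /= in_itv/= lee_fin => /m0.
move=> x [/[dup] xcd /gN] /[apply] -[h2 xE]; rewrite funepos_ge0/=.
rewrite funeposE fD// ge_max !lee_fin Dm//= m0//.
Unshelve. all: by end_near. Qed.

(** * Zeros of continuous functions and the largest delay *)

Lemma zeros_compact (R : realType) (f : R -> R) (c d : R) : c <= d ->
  {within `[c, d], continuous f} ->
  compact [set s | c <= s <= d /\ f s = 0].
Proof.
move=> cd fc; have FC := continuous_clamp cd fc.
rewrite (_ : mkset _ = `[c, d]%classic `&` (fun s => f (clamp c d s)) @^-1` [set 0]).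
  apply: compact_closedI; first exact: segment_compact.
  by apply: closed_comp => //; move=> x _; exact: FC.
apply/seteqP; split => s /=; rewrite in_itv/= => -[scd]; first by rewrite clamp_id.
by rewrite clamp_id.
Qed.

(** The zeros form a compact set, whose least element is the wanted point: by
the intermediate value theorem a nonnegative value before it would produce a
smaller zero. *)
Lemma first_zero (R : realType) (f : R -> R) (c d : R) : c <= d ->
  {within `[c, d], continuous f} -> f c < 0 -> 0 <= f d ->
  exists xi, [/\ c < xi <= d, f xi = 0 & forall s, c <= s < xi -> f s < 0].
Proof.
move=> cd fc fc0 fd0; pose Z := [set s | c <= s <= d /\ f s = 0].
have zero u v : c <= u -> u <= v -> v <= d -> f u < 0 -> 0 <= f v ->
    exists2 w, Z w & u <= w <= v.
  move=> cu uv vd fu fv; have [||w] := @IVT R f u v 0 uv.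
  - by apply: continuous_subspaceW fc; exact: subset_itvScc.
  - by rewrite ge_min (ltW fu)/= le_max fv orbT.
  rewrite in_itv/= => /andP[uw wv] fw; exists w; last by rewrite uw wv.
  by split => //; rewrite (le_trans cu uw) (le_trans wv vd).
have Z0 : Z !=set0 by have [w Zw _] := zero c d (lexx _) cd (lexx _) fc0 fd0; exists w.
have idc : {within Z, continuous (id : R -> R)}.
  by apply: continuous_subspaceT => x; exact: cvg_id.
have [xi] := compact_EVT_min Z0 (zeros_compact cd fc) idc.
rewrite inE => -[/andP[cxi xid] fxi] ximin; exists xi; split => //.
  rewrite xid andbT lt_neqAle cxi andbT; apply: contraTneq fc0 => ->.
  by rewrite fxi ltxx.
move=> s /andP[cs sxi]; rewrite ltNge; apply/negP => fs.
have [w Zw /andP[_ ws]] := zero c s (lexx _) cs (ltW (lt_le_trans sxi xid)) fc0 fs.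
by have := ximin w (mem_set Zw); rewrite leNgt (le_lt_trans ws sxi).
Qed.

(** The mirror image of [first_zero]. *)
Lemma last_zero (R : realType) (f : R -> R) (c d : R) : c <= d ->
  {within `[c, d], continuous f} -> f c <= 0 -> 0 < f d ->
  exists xi, [/\ c <= xi < d, f xi = 0 & forall s, xi < s <= d -> 0 < f s].
Proof.
move=> cd fc fc0 fd0; pose Z := [set s | c <= s <= d /\ f s = 0].
have zero u v : c <= u -> u <= v -> v <= d -> f u <= 0 -> 0 < f v ->
    exists2 w, Z w & u <= w <= v.
  move=> cu uv vd fu fv; have [||w] := @IVT R f u v 0 uv.
  - by apply: continuous_subspaceW fc; exact: subset_itvScc.
  - by rewrite ge_min fu/= le_max (ltW fv) orbT.
  rewrite in_itv/= => /andP[uw wv] fw; exists w; last by rewrite uw wv.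
  by split => //; rewrite (le_trans cu uw) (le_trans wv vd).
have Z0 : Z !=set0 by have [w Zw _] := zero c d (lexx _) cd (lexx _) fc0 fd0; exists w.
have idc : {within Z, continuous (id : R -> R)}.
  by apply: continuous_subspaceT => x; exact: cvg_id.
have [xi] := compact_EVT_max Z0 (zeros_compact cd fc) idc.
rewrite inE => -[/andP[cxi xid] fxi] ximax; exists xi; split => //.
  rewrite cxi lt_neqAle xid andbT; apply: contraTneq fd0 => <-.
  by rewrite fxi ltxx.
move=> s /andP[xis sd]; rewrite ltNge; apply/negP => fs.
have [w Zw /andP[sw _]] := zero s d (ltW (le_lt_trans cxi xis)) sd (lexx _) fs fd0.
by have := ximax w (mem_set Zw); rewrite leNgt (lt_le_trans xis sw).
Qed.

Lemma le_tau_max (R : realType) (n : nat) (tau : 'I_n -> R -> R) i s :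
  tau i s <= tau_max tau s.
Proof. by rewrite /tau_max; apply: le_bigmax. Qed.

Lemma tau_max_le (R : realType) (n : nat) (tau : 'I_n -> R -> R) s (r : R) :
  0 <= r -> (forall i, tau i s <= r) -> tau_max tau s <= r.
Proof. by move=> r0 taur; apply: bigmax_le. Qed.

Lemma continuous_tau_max (R : realType) (n : nat) (tau : 'I_n -> R -> R) :
  (forall i, continuous (tau i)) -> continuous (tau_max tau).
Proof.
move=> tauC; rewrite /tau_max.
elim: (index_enum _) => [|i l IH] x.
  rewrite (_ : (fun s => _) = (fun=> 0)); first exact: cvg_cst.
  by apply/funext => s; rewrite big_nil.
rewrite (_ : (fun s => _) =
    (fun s => Num.max (tau i s) (\big[Num.max/0]_(j <- l) tau j s))).
  by apply: continuous_max; [exact: tauC|exact: IH].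
by apply/funext => s; rewrite big_cons.
Qed.

(** * Contraction up to a decaying term *)

Definition posp (R : realType) (x : R) : R := Num.max 0 x.

Lemma posp_ge0 (R : realType) (x : R) : 0 <= posp x.
Proof. by rewrite le_max lexx. Qed.

Lemma posp_id (R : realType) (x : R) : 0 <= x -> posp x = x.
Proof. by move=> ?; exact: max_r. Qed.

Lemma posp0 (R : realType) (x : R) : x <= 0 -> posp x = 0.
Proof. by move=> ?; exact: max_l. Qed.

Lemma posp_le (R : realType) (x y : R) : 0 <= y -> x <= y -> posp x <= y.
Proof. by move=> y0 xy; rewrite ge_max y0. Qed.

Lemma le_posp (R : realType) (x y : R) : x <= y -> posp x <= posp y.
Proof. by move=> xy; apply: posp_le; rewrite ?posp_ge0// le_max xy orbT. Qed.

Lemma max_mono (R : realType) (x y u v : R) : x <= u -> y <= v ->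
  Num.max x y <= Num.max u v.
Proof. by move=> xu yv; rewrite ge_max !le_max xu yv orbT. Qed.

Lemma geometric_small (R : realType) (q M e : R) : 0 <= q < 1 -> 0 < e ->
  exists k : nat, q ^+ k * M <= e.
Proof.
move=> /andP[q0 q1] e0.
have cq : `|q| < 1 by rewrite ger0_norm.
have := cvgr_lt _ (cvg_geometric M cq) _ e0.
move=> [N _ /(_ N (leqnn N))]; rewrite /geometric /= => h; exists N.
by rewrite mulrC ltW.
Qed.

(** From [1 + b * u <= expR (b * u)]. *)
Lemma expR_decay (R : realType) (b X e : R) : 0 < b -> 0 < e ->
  exists2 u0, 0 <= u0 & forall u, u0 <= u -> X * expR (- b * u) <= e.
Proof.
move=> b0 e0; exists (posp X / (e * b)).
  by rewrite divr_ge0 ?posp_ge0// mulr_ge0// ltW.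
move=> u; rewrite ler_pdivrMr ?mulr_gt0// => hu.
rewrite mulNr expRN ler_pdivrMr ?expR_gt0//.
apply: (@le_trans _ _ (posp X)); first by rewrite le_max lexx orbT.
apply: (le_trans hu); rewrite mulrCA ler_wpM2l ?(ltW e0)//.
by rewrite mulrC; apply: le_trans (expR_ge1Dx _); rewrite ler_wpDl.
Qed.

Section Contraction.
Variables (R : realType) (V : R -> R) (S0 r q b : R).
Hypothesis q01 : 0 <= q < 1.
Hypothesis r_ge0 : 0 <= r.
Hypothesis b_gt0 : 0 < b.
Hypothesis V_step : forall S t X : R, S0 <= S -> S + r <= t -> 0 < X ->
  (forall s : R, S - r <= s -> s <= t -> V s <= X) ->
  V t <= Num.max (q * X) (posp (V (S + r)) * expR (- b * (t - (S + r)))).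

(** If [V <= M] on a bounded stretch, feeding the bound back into the step
replaces [M] by [max (q * M) K0]; local boundedness supplies a first [M], and
[q ^ k * M] falls below [K0]. *)
Lemma contraction_bounded (K0 : R) : 0 < K0 ->
  (forall t : R, exists M, forall s : R, S0 - r <= s -> s <= t -> V s <= M) ->
  (forall s : R, S0 - r <= s -> s <= S0 + r -> V s <= K0) ->
  forall t : R, S0 - r <= t -> V t <= K0.
Proof.
move=> K00 Vloc VK t St; have [M VM] := Vloc t.
have r0 := r_ge0; have /andP[q0 q1] := q01.
have claim k (s : R) : S0 - r <= s -> s <= t -> V s <= Num.max (q ^+ k * M) K0.
  elim: k s => [|k IH] s Ss st; first by rewrite le_max expr0 mul1r VM.
  have [sS|sS] := leP s (S0 + r); first by rewrite le_max VK ?orbT.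
  set X := Num.max (q ^+ k * M) K0 in IH.
  have X0 : 0 < X by rewrite lt_max K00 orbT.
  apply: le_trans (@V_step S0 s X _ _ X0 _) _ => //; first exact: ltW.
    by move=> u Su us; apply: IH => //; exact: le_trans st.
  rewrite ge_max; apply/andP; split.
    rewrite /X maxr_pMr// ge_max !le_max exprS mulrA lexx/=.
    by rewrite [X in _ || X]ler_piMl ?orbT// ltW.
  rewrite le_max; apply/orP; right.
  rewrite -[X in _ <= X]mulr1; apply: ler_pM; rewrite ?posp_ge0 ?expR_ge0//.
    apply: posp_le; rewrite ?(ltW K00)//; apply: VK => //.
    by rewrite lerD2l; lra.
  rewrite -expR0 ler_expR mulNr oppr_le0 mulr_ge0 ?(ltW b_gt0)//.
  by rewrite subr_ge0 ltW.
have [k qk] := geometric_small M q01 K00.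
apply: le_trans (claim k t St (lexx _)) _.
by rewrite ge_max qk lexx.
Qed.

(** Each step trades the bound [X], valid from [T] on, for [max (q * X) e],
valid from a later time at which the decaying term has become smaller than
[e]. *)
Lemma contraction_vanishes (K0 e : R) : 0 < e ->
  (forall t : R, S0 - r <= t -> V t <= K0) ->
  exists T, forall t, T <= t -> V t <= e.
Proof.
move=> e0 VK; have r0 := r_ge0; have /andP[q0 q1] := q01.
have claim k : exists2 T, S0 - r <= T &
    forall t, T <= t -> V t <= Num.max (q ^+ k * K0) e.
  elim: k => [|k [T ST IH]].
    by exists (S0 - r) => // t St; rewrite le_max expr0 mul1r VK.
  set X := Num.max (q ^+ k * K0) e in IH.
  have X0 : 0 < X by rewrite lt_max e0 orbT.
  have [u0 u00 Hu] := expR_decay X b_gt0 e0.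
  exists (T + r + r + u0); first by lra.
  move=> t Tt; apply: le_trans (@V_step (T + r) t X _ _ X0 _) _.
  - by lra.
  - by lra.
  - by move=> s Ts st; apply: IH; lra.
  rewrite ge_max; apply/andP; split.
    rewrite /X maxr_pMr// ge_max !le_max exprS mulrA lexx/=.
    by rewrite [X in _ || X]ler_piMl ?orbT// ltW.
  rewrite le_max; apply/orP; right.
  apply: le_trans (Hu (t - (T + r + r)) _); last by lra.
  rewrite ler_wpM2r ?expR_ge0//; apply: posp_le; first exact: ltW.
  by apply: IH; lra.
have [k qk] := geometric_small K0 q01 e0; have [T _ HT] := claim k.
exists T => t Tt; apply: le_trans (HT t Tt) _.
by rewrite ge_max qk lexx.
Qed.

End Contraction.

(** Any [w] strictly between [A2] and [1 / A1] works; it balances two one-sided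
bounds that are contractive only jointly. *)
Lemma weight_exists (R : realType) (A1 A2 : R) : 0 <= A1 -> 0 <= A2 ->
  A1 * A2 < 1 ->
  exists w q, [/\ 0 < w, 0 <= q < 1, A2 <= q * w & A1 * w <= q].
Proof.
move=> A10 A20 A12.
suff [w [w0 A2w A1w]] : exists w, [/\ 0 < w, A2 < w & A1 * w < 1].
  exists w, (Num.max (A2 / w) (A1 * w)); split => //.
  - rewrite gt_max A1w ltr_pdivrMr// mul1r A2w le_max andbT.
    by rewrite divr_ge0 ?(ltW w0).
  - by rewrite -ler_pdivrMr// le_max lexx.
  - by rewrite le_max lexx orbT.
have [->|A1n0] := eqVneq A1 0.
  by exists (A2 + 1); split; [lra|lra|rewrite mul0r].
have A1p : 0 < A1 by rewrite lt_neqAle eq_sym A1n0.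
have h : A2 < A1^-1 by rewrite -[A1^-1]mul1r ltr_pdivlMr// mulrC.
have h0 : 0 < A1^-1 by rewrite invr_gt0.
exists ((A2 + A1^-1) / 2); split; [by lra|by lra|].
by rewrite mulrC -ltr_pdivlMr// mul1r; lra.
Qed.

(** * Two-sided delay inequalities *)

Section DelayInequality.
Variables (R : realType) (n : nat).
Variables (a A : R -> R) (tau : 'I_n -> R -> R) (J : set R) (t0 r a0 K : R).

(** [z] is continuous from [t0] on, and away from the exceptional set [J] the
left derivative [D] of [z * expR A] is driven upwards only by earlier negative
values of [z] and downwards only by earlier positive values.  Two families of
coefficients are kept because the two directions come with different
constants. *)
Record delay_ineq (lam mu : 'I_n -> R -> R) (z D : R -> R) : Prop := DelayIneq {
  dineq_right : z u @[u --> t0^'+] --> z t0;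
  dineq_cont : forall s, t0 < s -> z u @[u --> s] --> z s;
  dineq_derive : forall s, t0 < s -> ~ J s ->
    is_left_derive (fun u => z u * expR (A u)) s (D s);
  dineq_upper : forall s, t0 < s -> ~ J s ->
    D s <= expR (A s) * \sum_i lam i s * posp (- z (s - tau i s));
  dineq_lower : forall s, t0 < s -> ~ J s ->
    - D s <= expR (A s) * \sum_i mu i s * posp (z (s - tau i s)) }.

(** Passing to [- z] exchanges the two directions, so every estimate is needed
for upper bounds only. *)
Lemma delay_ineqN lam mu z D : delay_ineq lam mu z D ->
  delay_ineq mu lam (fun u => - z u) (fun u => - D u).
Proof.
case=> h1 h2 h3 h4 h5; split.
- exact: cvgN.
- by move=> s ts; apply: cvgN; exact: h2.
- move=> s ts Js; rewrite (_ : (fun u => _) = (fun u => -1 * (z u * expR (A u)))).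
    by rewrite -(mulN1r (D s)); apply: left_deriveZ; exact: h3.
  by apply/funext => u; rewrite mulN1r mulNr.
- move=> s ts Js; apply: le_trans (h5 s ts Js) _.
  by under [X in _ <= _ * X]eq_bigr do rewrite opprK.
- by move=> s ts Js; rewrite opprK; exact: h4.
Qed.

Hypothesis AD : forall s, t0 <= s -> is_derive s 1 A (a s).
Hypothesis a0_gt0 : 0 < a0.
Hypothesis a_ge : forall s, a0 <= a s.
Hypothesis tau_gt0 : forall i s, 0 < tau i s.
Hypothesis tau_le : forall i s, tau i s <= r.
Hypothesis r_ge0 : 0 <= r.
Hypothesis tau_cont : forall i, continuous (tau i).
Hypothesis tau_mono : forall i, {homo (fun s => s - tau i s) : x y / x <= y}.
Hypothesis J_fin : forall t, exists E : seq R, forall s, J s -> s <= t -> s \in E.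
Hypothesis K_ge0 : 0 <= K.

Lemma continuous_A s : t0 <= s -> A u @[u --> s] --> A s.
Proof.
move=> ts; apply/differentiable_continuous/derivable1_diffP.
by case: (AD ts).
Qed.

Lemma continuous_expA s : t0 <= s -> expR (A u) @[u --> s] --> expR (A s).
Proof. by move=> ts; apply: continuous_cvg; [exact: continuous_expR|exact: continuous_A]. Qed.

Lemma within_continuous_half (f : R -> R) c d :
  f u @[u --> t0^'+] --> f t0 -> (forall s, t0 < s -> f u @[u --> s] --> f s) ->
  t0 <= c -> c <= d -> {within `[c, d], continuous f}.
Proof.
move=> f0 fs tc; rewrite le_eqVlt => /predU1P[<-|cd].
  by rewrite set_itv1; exact: continuous_subspace1.
apply/continuous_within_itvP => //; split.
- by move=> x; rewrite in_itv/= => /andP[cx _]; apply: fs; exact: le_lt_trans cx.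
- move: tc; rewrite le_eqVlt => /predU1P[<- //|tc].
  by apply: cvg_within_filter; exact: fs.
- by apply: cvg_within_filter; apply: fs; exact: le_lt_trans cd.
Qed.

Lemma A_growth s t : t0 <= s -> s <= t -> a0 * (t - s) <= A t - A s.
Proof.
move=> ts st.
have : A s + - a0 * s <= A t + - a0 * t.
  apply: (@left_derive_ndecr _ [::] (fun u => A u + - a0 * u)) => //.
    apply: within_continuous_half => //.
      apply: cvgD; last by apply: cvgMr; exact: cvg_at_right_filter.
      by apply: cvg_at_right_filter; exact: continuous_A.
    move=> u tu; apply: cvgD; first by apply: continuous_A; exact: ltW.
    by apply: cvgMr; exact: cvg_id.
  move=> u /andP[su _] _; exists (a u + - a0 * 1); last by rewrite mulr1 subr_ge0.
  apply: left_deriveD; last by apply: left_deriveZ; exact: is_derive_left_derive.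
  by apply: is_derive_left_derive; apply: AD; rewrite (le_trans ts)// ltW.
by rewrite mulrBr; lra.
Qed.

Lemma A_ndecr s t : t0 <= s -> s <= t -> A s <= A t.
Proof.
move=> ts st; rewrite -subr_ge0; apply: le_trans (A_growth ts st).
by rewrite mulr_ge0 ?subr_ge0// ltW.
Qed.

Section Pair.
Variables (lam mu : 'I_n -> R -> R) (z D : R -> R).
Hypothesis zD : delay_ineq lam mu z D.
Hypothesis lam_ge0 : forall i s, 0 <= lam i s.
Hypothesis mu_ge0 : forall i s, 0 <= mu i s.
Hypothesis lamK : forall s, t0 <= s -> \sum_i lam i s <= K.
Hypothesis muK : forall s, t0 <= s -> \sum_i mu i s <= K.

Lemma dineq_within c d : t0 <= c -> c <= d -> {within `[c, d], continuous z}.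
Proof.
move=> tc cd; apply: within_continuous_half tc cd.
  exact: dineq_right zD.
exact: dineq_cont zD.
Qed.

Lemma dineq_expA_within c d : t0 <= c -> c <= d ->
  {within `[c, d], continuous (fun u => z u * expR (A u))}.
Proof.
move=> tc cd; apply: within_continuous_half tc cd.
  apply: cvgM; first exact: dineq_right zD.
  by apply: cvg_at_right_filter; exact: continuous_expA.
move=> s ts; apply: cvgM; first exact: (dineq_cont zD).
by apply: continuous_expA; exact: ltW.
Qed.

Lemma J_seq c d : exists E : seq R, forall s, c < s < d -> s \notin E -> ~ J s.
Proof.
have [E HE] := J_fin d; exists E => s /andP[_ /ltW sd] sE Js.
by move/negP : sE; apply; exact: HE.
Qed.

(** If [|z| <= B] up to [t], with [B] growing at rate [K], then [B - z]
multiplied by [expR A] has a nonnegative left derivative, so the strict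
inequality at [t0] persists up to [t]. *)
Lemma gronwall_up (B : R -> R) (delta t : R) : 0 < delta -> t0 <= t ->
  B = (fun s => delta * expR (K * (s - t0))) ->
  (forall s : R, t0 - r <= s -> s <= t0 -> `|z s| < delta) ->
  (forall s, t0 <= s -> s <= t -> `|z s| <= B s) ->
  z t < B t.
Proof.
move=> d0 tt BE hist zB.
have B_ge s : t0 <= s -> delta <= B s.
  move=> ts; rewrite BE ler_peMr ?(ltW d0)// -expR0 ler_expR.
  by rewrite mulr_ge0 ?subr_ge0.
have B_homo s u : s <= u -> B s <= B u.
  move=> su; rewrite BE ler_pM2l// ler_expR ler_wpM2l// lerD2r.
  exact: su.
have BD (s : R) : is_derive s 1 B (K * B s).
  rewrite BE.
  have i1 : is_derive s 1 (fun u => K * (u - t0)) (K * 1).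
    rewrite (_ : (fun u => _) = (fun u => K *: (u - t0)))//.
    by apply: is_derive_eq; rewrite subr0 /GRing.scale.
  have i2 := @is_derive1_comp _ expR (fun u => K * (u - t0)) s _ _ (is_derive_expR _) i1.
  rewrite (_ : (fun u => _) = (fun u => delta *: (expR \o (fun u => K * (u - t0))) u))//.
  by apply: is_derive_eq; rewrite /GRing.scale/=; ring.
have BC (s : R) : B u @[u --> s] --> B s.
  by apply/differentiable_continuous/derivable1_diffP; case: (BD s).
have [E HE] := J_seq t0 t.
have zBt0 : z t0 < B t0.
  apply: lt_le_trans (B_ge _ (lexx _)); apply: le_lt_trans (ler_norm _) _.
  by apply: hist => //; rewrite gerBl.
have : expR (A t0) * (B t0 - z t0) <= expR (A t) * (B t - z t).
  rewrite !mulrBr !(mulrC (expR _)) -![- (_ * _)]mulN1r.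
  apply: (@left_derive_ndecr _ E (fun u => B u * expR (A u) + -1 * (z u * expR (A u)))) => //.
    apply: (@within_continuousD _ _ _ _ (fun u => B u * expR (A u)) (fun u => -1 * (z u * expR (A u)))).
      apply: within_continuous_half => //.
        by apply: cvg_at_right_filter; apply: cvgM; [exact: BC|exact: continuous_expA].
      by move=> s /ltW ts; apply: cvgM; [exact: BC|exact: continuous_expA].
    by move=> x; apply: cvgMr; exact: dineq_expA_within.
  move=> s /[dup] st' /andP[ts st] /(HE _ st') Js.
  exists ((K * B s) * expR (A s) + B s * (expR (A s) * a s) + -1 * D s).
    apply: left_deriveD.
      apply: left_deriveM; first exact: is_derive_left_derive.
      exact: (@is_derive1_comp _ expR A s _ _ (is_derive_expR _) (AD (ltW ts))).
    by apply: left_deriveZ; exact: (dineq_derive zD).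
  have h1 : D s <= expR (A s) * (K * B s).
    apply: le_trans (dineq_upper zD ts Js) _; rewrite ler_pM2l ?expR_gt0//.
    have Bs0 : 0 <= B s by apply: le_trans (B_ge _ (ltW ts)); exact: ltW.
    apply: (@le_trans _ _ (\sum_i lam i s * B s)).
      apply: ler_sum => i _; apply: ler_wpM2l => //.
      apply: posp_le => //; apply: le_trans (ler_norm _) _; rewrite normrN.
      have [w|w] := leP (s - tau i s) t0.
        apply: le_trans (B_ge s (ltW ts)); apply/ltW/hist => //.
        have := tau_le i s; lra.
      have ws : s - tau i s <= s by rewrite gerBl ltW.
      apply: le_trans (zB _ (ltW w) _) (B_homo _ _ ws).
      by apply: le_trans ws _; exact: ltW.
    by rewrite -mulr_suml ler_wpM2r// lamK// ltW.
  have h2 : 0 <= B s * (expR (A s) * a s).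
    rewrite mulr_ge0// ?mulr_ge0 ?expR_ge0//.
      by apply: le_trans (B_ge _ (ltW ts)); exact: ltW.
    by apply: le_trans (a_ge s); exact: ltW.
  by move: h1; rewrite mulN1r (mulrC (expR _)); lra.
rewrite -(subr_gt0 (z t)) => h; rewrite -(pmulr_rgt0 _ (expR_gt0 (A t))).
by apply: lt_le_trans h; rewrite mulr_gt0 ?expR_gt0// subr_gt0.
Qed.


(** While all delayed values are nonnegative, nothing drives [z] upwards. *)
Lemma dineq_expA_nincr (c d : R) : t0 <= c -> c <= d ->
  (forall i s, c < s < d -> 0 <= z (s - tau i s)) ->
  z d * expR (A d) <= z c * expR (A c).
Proof.
move=> tc cd zpos; have [E HE] := J_seq c d.
rewrite -lerN2 -(mulN1r (z d * _)) -(mulN1r (z c * _)).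
apply: (@left_derive_ndecr _ E (fun u => -1 * (z u * expR (A u)))) => //.
  by move=> x; apply: cvgMr; exact: dineq_expA_within.
move=> s /[dup] scd /andP[cs sd] /(HE _ scd) Js.
have ts := le_lt_trans tc cs.
exists (-1 * D s); first by apply: left_deriveZ; exact: (dineq_derive zD).
rewrite mulN1r oppr_ge0; apply: le_trans (dineq_upper zD ts Js) _.
rewrite big1 ?mulr0// => i _; rewrite posp0 ?mulr0// oppr_le0.
exact: zpos.
Qed.

(** The rise of [z * expR A] from a zero [xi] to [c], divided by [m * expR (A c)],
is at most the integral of the coefficients over [[xi, c]], which is part of
the window of length [tau_max tau c] ending at [c]. *)
Lemma dineq_rise (xi c m alpha M : R) : t0 <= xi -> xi < c -> 0 < m ->
  c - tau_max tau c <= xi -> z xi = 0 ->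
  (forall s, xi - r <= s -> s <= c -> - m <= z s <= M) ->
  (\int[@lebesgue_measure R]_(s in `[(c - tau_max tau c)%R, c])
     ((\sum_i lam i s * expR (A s - A c))%R)%:E <= alpha%:E)%E ->
  z c <= alpha * m.
Proof.
move=> txi xic m0 cxi zxi zM Halpha.
have xc := ltW xic; have tc := le_trans txi xc.
have [E HE] := J_seq xi c.
pose k := (m * expR (A c))^-1.
have mA0 : 0 < m * expR (A c) by rewrite mulr_gt0// expR_gt0.
have k0 : 0 < k by rewrite invr_gt0.
have M0 : 0 <= posp M + m by rewrite addr_ge0 ?posp_ge0// ltW.
have bnd s i : xi < s < c -> posp (- z (s - tau i s)) <= m /\
    posp (z (s - tau i s)) <= posp M + m.
  move=> /andP[xs sc].
  have /andP[lo hi] : - m <= z (s - tau i s) <= M.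
    have h1 := tau_le i s; have h2 := tau_gt0 i s.
    by apply: zM; lra.
  split; first by apply: posp_le; rewrite ?(ltW m0)//; lra.
  apply: posp_le => //; apply: le_trans hi _; apply: ler_wpDr; first exact: ltW.
  by rewrite le_max lexx orbT.
have h : ((k * (z c * expR (A c)) - k * (z xi * expR (A xi)))%:E <=
   \int[@lebesgue_measure R]_(s in `[xi, c])
     ((\sum_i lam i s * expR (A s - A c))%R)%:E)%E.
  apply: (@left_derive_le_integral _ E (fun u => k * (z u * expR (A u)))
    (fun s => k * D s) _ _ _ (k * (expR (A c) * (K * (posp M + m))))) => //.
  - by rewrite !mulr_ge0 ?expR_ge0// ltW.
  - by move=> x; apply: cvgMr; exact: dineq_expA_within.
  - move=> s /[dup] scd /andP[cs sd] /(HE _ scd) Js; apply: left_deriveZ.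
    by apply: (dineq_derive zD) => //; exact: le_lt_trans cs.
  - move=> s /[dup] scd /andP[cs sd] /(HE _ scd) Js.
    have ts := le_lt_trans txi cs.
    rewrite normrM (ger0_norm (ltW k0)) ler_pM2l//.
    have eAs : expR (A s) <= expR (A c) by rewrite ler_expR A_ndecr// ltW.
    have est (w : 'I_n -> R -> R) (y : 'I_n -> R) : (forall i u, 0 <= w i u) ->
        \sum_i w i s <= K -> (forall i, 0 <= y i <= posp M + m) ->
        expR (A s) * (\sum_i w i s * y i) <= expR (A c) * (K * (posp M + m)).
      move=> w0 wK yM; apply: ler_pM => //; rewrite ?expR_ge0//.
        by apply: sumr_ge0 => i _; rewrite mulr_ge0//; case/andP: (yM i).
      apply: (@le_trans _ _ (\sum_i w i s * (posp M + m))).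
        by apply: ler_sum => i _; apply: ler_wpM2l => //; case/andP: (yM i).
      by rewrite -mulr_suml ler_wpM2r.
    rewrite ler_norml; apply/andP; split.
      rewrite lerNl; apply: le_trans (dineq_lower zD ts Js) _.
      apply: est; [exact: mu_ge0|exact: muK (ltW ts)|].
      by move=> i; rewrite posp_ge0/=; case: (bnd s i scd).
    apply: le_trans (dineq_upper zD ts Js) _.
    apply: est; [exact: lam_ge0|exact: lamK (ltW ts)|].
    move=> i; rewrite posp_ge0/=; case: (bnd s i scd) => [h _].
    by apply: le_trans h _; rewrite lerDr posp_ge0.
  - by move=> s _; apply: sumr_ge0 => i _; rewrite mulr_ge0// expR_ge0.
  - move=> s /[dup] scd /andP[cs sd] /(HE _ scd) Js.
    have ts := le_lt_trans txi cs.
    rewrite /k mulrC ler_pdivrMr//.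
    apply: le_trans (dineq_upper zD ts Js) _.
    have eE : expR (A s) = expR (A s - A c) * expR (A c) by rewrite -expRD subrK.
    rewrite eE mulr_suml mulr_sumr; apply: ler_sum => i _.
    set e := expR (A s - A c); set w := posp _.
    rewrite (_ : e * _ * _ = lam i s * e * (w * expR (A c))); last by ring.
    apply: ler_wpM2l; first by rewrite mulr_ge0 ?expR_ge0.
    by apply: ler_wpM2r; [exact: expR_ge0|case: (bnd s i scd)].
have kE : k * (z c * expR (A c)) - k * (z xi * expR (A xi)) = z c / m.
  rewrite zxi mul0r mulr0 subr0 /k.
  have := expR_gt0 (A c); move: (expR _) => e e0.
  by field; rewrite ?(gt_eqF e0) ?(gt_eqF m0).
rewrite -ler_pdivrMr// -lee_fin -kE.
apply: (le_trans h); apply: le_trans Halpha; apply: le_lower_integral.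
- move=> s /=; rewrite !in_itv/= => /andP[xs ->]; rewrite andbT.
  exact: le_trans cxi xs.
- move=> s _; rewrite lee_fin; apply: sumr_ge0 => i _.
  by rewrite mulr_ge0// expR_ge0.
- move=> s _; rewrite lexx andbT lee_fin; apply: sumr_ge0 => i _.
  by rewrite mulr_ge0// expR_ge0.
Qed.

(** Three cases: [z t <= 0]; [z] positive since [S], and then decaying from
[S + r] on; or a last zero [xi].  In the last case the rise stops at the time
[c] at which the earliest delayed argument [c - tau_max tau c] reaches [xi],
or at [t] if that comes first. *)
Lemma yorke (S alpha m M t : R) : t0 <= S -> S + r <= t -> 0 < m ->
  (forall c, S <= c -> (\int[@lebesgue_measure R]_(s in
       `[(c - tau_max tau c)%R, c])
     ((\sum_i lam i s * expR (A s - A c))%R)%:E <= alpha%:E)%E) ->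
  (forall s, S - r <= s -> s <= t -> - m <= z s <= M) ->
  z t <= Num.max (alpha * m) (posp (z (S + r)) * expR (- a0 * (t - (S + r)))).
Proof.
move=> tS Srt m0 Halpha zM.
have tSr : t0 <= S + r by apply: ler_wpDr.
have St : S <= t by apply: le_trans Srt; apply: ler_wpDr.
have [zt|zt] := leP (z t) 0.
  by rewrite le_max; apply/orP; right; apply: le_trans zt _; rewrite mulr_ge0 ?posp_ge0 ?expR_ge0.
have [allpos|] := pselect (forall s, S <= s -> s <= t -> 0 < z s).
  rewrite le_max; apply/orP; right.
  have zSr : 0 < z (S + r) by apply: allpos => //; exact: ler_wpDr.
  rewrite (posp_id (ltW zSr)).
  have : z t * expR (A t) <= z (S + r) * expR (A (S + r)).
    apply: dineq_expA_nincr => // i s /andP[Srs st]; apply/ltW/allpos.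
      by have := tau_le i s; lra.
    by have := tau_gt0 i s; lra.
  rewrite -ler_pdivlMr ?expR_gt0// -mulrA -expRN -expRD => H.
  apply: le_trans H _.
  rewrite ler_wpM2l ?(ltW zSr)// ler_expR mulNr lerNr opprB.
  exact: A_growth.
move=> /existsNP[s1 /not_implyP[Ss1 /not_implyP[s1t /negP]]]; rewrite -leNgt => zs1.
have [|xi [/andP[s1xi xit] zxi zpos]] := last_zero s1t _ zs1 zt.
  by apply: dineq_within s1t; exact: le_trans tS Ss1.
have Sxi := le_trans Ss1 s1xi; have txi := le_trans tS Sxi.
have tmc : continuous (fun s => s - tau_max tau s).
  by move=> u; apply: cvgB; [exact: cvg_id|exact: continuous_tau_max].
have [c [xic ct cxi cpos]] : exists c, [/\ xi <= c, c <= t,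
    c - tau_max tau c <= xi & forall i s, c < s < t -> xi <= s - tau i s].
  have [tmt|tmt] := leP (t - tau_max tau t) xi.
    exists t; split => //; first exact: ltW.
    by move=> i s /andP[/lt_trans + /[dup]] => /[apply]; rewrite ltxx.
  have [||c] := @IVT R (fun s => s - tau_max tau s) xi t xi (ltW xit).
  - exact: continuous_subspaceT.
  - rewrite ge_min le_max (ltW tmt) orbT andbT gerBl.
    by rewrite /tau_max bigmax_ge_id.
  rewrite in_itv/= => /andP[xic ct] cE; exists c; split => //; first by rewrite cE.
  move=> i s /andP[cs _]; apply: (@le_trans _ _ (c - tau i c)).
    by rewrite -[X in X <= _]cE lerD2l lerN2 le_tau_max.
  by apply: tau_mono; exact: ltW.
have tc := le_trans txi xic.
have zc0 : 0 <= z c.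
  by move: xic; rewrite le_eqVlt => /predU1P[<-|xic]; [rewrite zxi|apply/ltW/zpos; rewrite xic].
have ztc : z t <= z c.
  have H : z t * expR (A t) <= z c * expR (A c).
    apply: dineq_expA_nincr => // i s /[dup] cst /andP[cs st].
    have := cpos i s cst; rewrite le_eqVlt => /predU1P[<-|xs]; first by rewrite zxi.
    by apply/ltW/zpos; rewrite xs/=; have := tau_gt0 i s; lra.
  have H2 : z c * expR (A c) <= z c * expR (A t).
    by rewrite ler_wpM2l// ler_expR A_ndecr.
  by have := le_trans H H2; rewrite ler_pM2r// expR_gt0.
rewrite le_max; apply/orP; left; apply: (le_trans ztc).
move: (xic); rewrite le_eqVlt => /predU1P[xicE|{}xic].
  suff : z t <= 0 by rewrite leNgt zt.
  by rewrite -zxi xicE; exact: ztc.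
apply: (@dineq_rise xi c m alpha M) => //.
- move=> s xs sc; apply: zM; last exact: le_trans ct.
  by apply: le_trans xs; rewrite lerD2r.
- by apply: Halpha; apply: le_trans Sxi _; exact: ltW.
Qed.

End Pair.

(** At the first time at which [|z|] meets the barrier [delta * expR (K * (t - t0))],
[gronwall_up] for [z] and for [- z] shows that it has not been met. *)
Lemma gronwall (lam mu : 'I_n -> R -> R) (z D : R -> R) (delta t : R) :
  delay_ineq lam mu z D ->
  (forall i s, 0 <= lam i s) -> (forall i s, 0 <= mu i s) ->
  (forall s, t0 <= s -> \sum_i lam i s <= K) ->
  (forall s, t0 <= s -> \sum_i mu i s <= K) ->
  0 < delta -> (forall s, t0 - r <= s -> s <= t0 -> `|z s| < delta) ->
  t0 <= t -> `|z t| < delta * expR (K * (t - t0)).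
Proof.
move=> zD lam0 mu0 lamK muK d0 hist tt.
pose B s := delta * expR (K * (s - t0)).
rewrite ltNge; apply/negP => zt.
have BC s : B u @[u --> s] --> B s.
  apply: cvgMr; apply: continuous_cvg; first exact: continuous_expR.
  by apply: cvgMr; apply: cvgB; [exact: cvg_id|exact: cvg_cst].
have [|||xi [/andP[txi xit] fxi flt]] :=
    @first_zero R (fun s => `|z s| - B s) t0 t tt.
- apply: within_continuous_half => //.
    apply: cvgB; first by apply: cvg_norm; exact: dineq_right zD.
    exact: cvg_at_right_filter.
  move=> s ts; apply: cvgB; last exact: BC.
  by apply: cvg_norm; exact: (dineq_cont zD).
- rewrite /B subrr mulr0 expR0 mulr1 subr_lt0; apply: hist => //.
  by rewrite gerBl.
- by rewrite subr_ge0.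
have txi' := ltW txi.
have zB s : t0 <= s -> s <= xi -> `|z s| <= B s.
  move=> ts; rewrite le_eqVlt => /predU1P[->|sxi].
    by rewrite -subr_le0 fxi.
  by rewrite -subr_le0; apply/ltW/flt; rewrite ts.
have u1 : z xi < B xi by exact: (@gronwall_up lam mu z D zD lam0 lamK B delta).
have u2 : - z xi < B xi.
  apply: (@gronwall_up mu lam _ _ (delay_ineqN zD) mu0 muK B delta) => //.
    by move=> s; rewrite normrN; exact: hist.
  by move=> s; rewrite normrN; exact: zB.
have : `|z xi| < B xi by rewrite ltr_norml u1 andbT ltrNl.
by rewrite -subr_lt0 fxi ltxx.
Qed.

Section Balance.
Variables (lam mu : 'I_n -> R -> R) (z D : R -> R) (S0 A1 A2 w q : R).
Hypothesis zD : delay_ineq lam mu z D.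
Hypothesis lam_ge0 : forall i s, 0 <= lam i s.
Hypothesis mu_ge0 : forall i s, 0 <= mu i s.
Hypothesis lamK : forall s, t0 <= s -> \sum_i lam i s <= K.
Hypothesis muK : forall s, t0 <= s -> \sum_i mu i s <= K.
Hypothesis tS0 : t0 <= S0.
Hypothesis alpha_lam : forall c, S0 <= c ->
  (\int[@lebesgue_measure R]_(s in `[(c - tau_max tau c)%R, c])
     ((\sum_i lam i s * expR (A s - A c))%R)%:E <= A2%:E)%E.
Hypothesis alpha_mu : forall c, S0 <= c ->
  (\int[@lebesgue_measure R]_(s in `[(c - tau_max tau c)%R, c])
     ((\sum_i mu i s * expR (A s - A c))%R)%:E <= A1%:E)%E.
Hypothesis w_gt0 : 0 < w.
Hypothesis q01 : 0 <= q < 1.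
Hypothesis A2w : A2 <= q * w.
Hypothesis A1w : A1 * w <= q.

Let V s := Num.max (z s / w) (- z s).

Lemma balance_le s X : (V s <= X) = (- X <= z s <= w * X).
Proof. by rewrite /V ge_max ler_pdivrMr// andbC lerNl mulrC. Qed.

Lemma balance_norm s X : `|z s| <= X -> V s <= Num.max w^-1 1 * X.
Proof.
move=> zX; have X0 := le_trans (normr_ge0 _) zX.
move: zX; rewrite ler_norml => /andP[z1 z2].
rewrite ge_max; apply/andP; split.
  apply: (@le_trans _ _ (w^-1 * X)).
    by rewrite mulrC ler_wpM2l// invr_ge0 ltW.
  by rewrite ler_wpM2r// le_max lexx.
apply: (@le_trans _ _ (1 * X)); first by rewrite mul1r lerNl.
by rewrite ler_wpM2r// le_max lexx orbT.
Qed.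

Lemma norm_balance s X : V s <= X -> `|z s| <= Num.max w 1 * X.
Proof.
rewrite balance_le => /andP[z1 z2].
have X0 : 0 <= X.
  rewrite leNgt; apply/negP => X0.
  by have := mulr_gt0 w_gt0 (_ : 0 < - X); rewrite oppr_gt0 mulrN => /(_ X0); lra.
rewrite ler_norml; apply/andP; split.
  apply: le_trans z1; rewrite lerN2 -[X in X <= _]mul1r ler_wpM2r//.
  by rewrite le_max lexx orbT.
by apply: (le_trans z2); rewrite ler_wpM2r// le_max lexx.
Qed.

(** [V <= X] says that [- X <= z <= w * X].  The two one-sided estimates turn
this into [z <= A2 * X <= q * w * X] and [- z <= A1 * w * X <= q * X], up to
the decaying terms. *)
Lemma balance_step S t X : S0 <= S -> S + r <= t -> 0 < X ->
  (forall s : R, S - r <= s -> s <= t -> V s <= X) ->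
  V t <= Num.max (q * X) (posp (V (S + r)) * expR (- a0 * (t - (S + r)))).
Proof.
move=> S0S Srt X0 VX; have tS := le_trans tS0 S0S.
have up : z t <= Num.max (A2 * X) (posp (z (S + r)) * expR (- a0 * (t - (S + r)))).
  apply: (yorke zD lam_ge0 mu_ge0 lamK muK (M := w * X) tS Srt X0).
    by move=> c Sc; apply: alpha_lam; exact: le_trans Sc.
  by move=> s Ss st; rewrite -balance_le VX.
have dn : - z t <= Num.max (A1 * (w * X)) (posp (- z (S + r)) * expR (- a0 * (t - (S + r)))).
  apply: (yorke (delay_ineqN zD) mu_ge0 lam_ge0 muK lamK (M := X) tS Srt _).
  - by rewrite mulr_gt0.
  - by move=> c Sc; apply: alpha_mu; exact: le_trans Sc.
  - by move=> s Ss st; rewrite lerN2 lerNl andbC -balance_le VX.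
have e0 := expR_ge0 (- a0 * (t - (S + r))).
rewrite [V t]/V ge_max; apply/andP; split.
  rewrite ler_pdivrMr//; apply: (le_trans up).
  have mw x y : Num.max x y * w = Num.max (x * w) (y * w).
    by rewrite maxr_pMl// ltW.
  rewrite mw.
  apply: max_mono.
    by rewrite mulrAC ler_wpM2r// ltW.
  rewrite mulrAC ler_wpM2r// -ler_pdivrMr//.
  rewrite ler_pdivrMr//; apply: posp_le; first by rewrite mulr_ge0 ?posp_ge0// ltW.
  by rewrite -ler_pdivrMr// /posp !le_max lexx orbT.
apply: (le_trans dn); apply: max_mono.
  by rewrite mulrA ler_wpM2r// ltW.
by rewrite ler_wpM2r// le_posp// le_max lexx orbT.
Qed.

(** [gronwall] controls [z] up to [S0 + r], and [contraction_bounded] carries the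
bound on from there. *)
Lemma delay_ineq_stable delta : 0 < delta ->
  (forall s : R, t0 - r <= s -> s <= t0 -> `|z s| < delta) ->
  forall t, t0 <= t -> `|z t| <=
    Num.max w 1 * (Num.max w^-1 1 * (delta * expR (K * (S0 + r - t0)))).
Proof.
move=> d0 hist t tt; have r0 := r_ge0; have tS := tS0.
have gr u s : s <= u -> t0 - r <= s -> t0 <= u -> `|z s| <= delta * expR (K * (u - t0)).
  move=> su ts tu; have [st|st] := leP s t0.
    apply: ltW; apply: lt_le_trans (hist s ts st) _.
    by rewrite ler_peMr ?(ltW d0)// -expR0 ler_expR mulr_ge0 ?subr_ge0.
  apply: ltW; apply: lt_le_trans (gronwall zD lam_ge0 mu_ge0 lamK muK d0 hist (ltW st)) _.
  by rewrite ler_pM2l// ler_expR ler_wpM2l// lerD2r.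
have K00 : 0 < Num.max w^-1 1 * (delta * expR (K * (S0 + r - t0))).
  by rewrite !mulr_gt0 ?expR_gt0// lt_max ltr01 orbT.
apply: norm_balance.
have [tSr|Srt] := leP t (S0 + r).
  by apply: balance_norm; apply: gr => //; lra.
apply: (@contraction_bounded R V S0 r q a0 q01 r_ge0 a0_gt0 balance_step _ K00) => //.
- move=> u; exists (Num.max w^-1 1 * (delta * expR (K * (Num.max u t0 - t0)))).
  move=> s Ss su; apply: balance_norm; apply: gr; last by rewrite le_max lexx orbT.
    by rewrite le_max su.
  by lra.
- by move=> s Ss sS; apply: balance_norm; apply: gr => //; lra.
- by lra.
Qed.

(** Since [t0 + r <= S0], the first window lies in the range where [z] is
continuous, hence bounded; continuity thus supplies all the bounds. *)
Lemma delay_ineq_vanishes : t0 + r <= S0 ->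
  forall e, 0 < e -> exists T, forall t, T <= t -> `|z t| <= e.
Proof.
move=> trS e e0; have r0 := r_ge0.
have tSr : t0 <= S0 - r by lra.
have Vloc t : exists M, forall s : R, S0 - r <= s -> s <= t -> V s <= M.
  have [tS|St] := leP t (S0 - r).
    exists (V (S0 - r)) => s Ss st.
    by have -> : s = S0 - r by apply/eqP; rewrite eq_le Ss (le_trans st tS).
  have nc : {within `[S0 - r, t], continuous (fun s => `|z s|)}.
    have zc := dineq_within zD tSr (ltW St).
    by move=> x; apply: cvg_norm; exact: zc.
  have [c _ cM] := EVT_max (ltW St) nc.
  exists (Num.max w^-1 1 * `|z c|) => s Ss st; apply: balance_norm; apply: cM.
  by rewrite in_itv/= Ss.
have [M HM] := Vloc (S0 + r).
have K00 : 0 < posp M + 1 by rewrite ltr_wpDl ?posp_ge0.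
have VK : forall t : R, S0 - r <= t -> V t <= posp M + 1.
  apply: (@contraction_bounded R V S0 r q a0 q01 r_ge0 a0_gt0 balance_step _ K00) => //.
  move=> s Ss sS; apply: le_trans (HM s Ss sS) _; rewrite ler_wpDr//.
  by rewrite le_max lexx orbT.
have w10 : 0 < Num.max w 1 by rewrite lt_max ltr01 orbT.
have e0' : 0 < e / Num.max w 1 by rewrite divr_gt0.
have [T HT] := @contraction_vanishes R V S0 r q a0 q01 r_ge0 a0_gt0 balance_step _ _ e0' VK.
exists T => t Tt; apply: le_trans (norm_balance (HT t Tt)) _.
by rewrite mulrC mulfVK ?gt_eqF.
Qed.

End Balance.

End DelayInequality.

(** * Periodic sequences and impulse times *)

Section PeriodicSequences.
Variables (R : realType) (p : nat).
Hypothesis p_gt0 : (0 < p)%N.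

Lemma periodic_modn (T : Type) (f : nat -> T) :
  (forall k, f (k + p)%N = f k) -> forall k, f k = f (k %% p)%N.
Proof.
move=> fp k; rewrite {1}(divn_eq k p); elim: (k %/ p)%N => [|j IH].
  by rewrite mul0n add0n.
by rewrite mulSn -addnA addnC fp.
Qed.

Lemma periodic_bounded (f : nat -> R) : (forall k, f (k + p)%N = f k) ->
  exists2 c, 1 <= c & forall k, f k <= c.
Proof.
move=> fp; exists (1 + \sum_(k < p) `|f k|).
  by rewrite lerDl sumr_ge0.
move=> k; rewrite (periodic_modn fp) ler_wpDl//.
rewrite (bigD1 (Ordinal (ltn_pmod k p_gt0)))//=.
by apply: le_trans (ler_norm _) _; rewrite lerDl sumr_ge0.
Qed.

Lemma prod_le_expn (f : nat -> R) (c : R) (i j N : nat) : 1 <= c ->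
  (forall k, 0 <= f k <= c) -> (j - i <= N)%N ->
  \prod_(i <= k < j) f k <= c ^+ N.
Proof.
move=> c1 fc ijN; apply: (@le_trans _ _ (\prod_(i <= k < j) c)).
  by apply: ler_prod => k _; exact: fc.
by rewrite prodr_const_nat ler_weXn2l.
Qed.

(** Every block of [p] consecutive factors has the product over one period, at
most 1; removing such blocks leaves fewer than [p] factors. *)
Lemma prod_periodic_bounded (f : nat -> R) : (forall k, f (k + p)%N = f k) ->
  (forall k, 0 <= f k) -> \prod_(k < p) f k <= 1 ->
  exists2 C, 0 < C & forall i j, \prod_(i <= k < j) f k <= C.
Proof.
move=> fp f0 f1; have [c c1 fc] := periodic_bounded fp.
have c0 : 0 < c by apply: lt_le_trans c1; exact: ltr01.
exists (c ^+ p); first exact: exprn_gt0.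
have block i : \prod_(i <= k < i + p) f k <= 1.
  elim: i => [|i IH]; first by rewrite add0n big_mkord.
  have ip : (i < i + p)%N by rewrite -{1}(addn0 i) ltn_add2l.
  by rewrite addSn big_nat_recr//= fp mulrC -big_ltn.
have claim m i : \prod_(i <= k < i + m) f k <= c ^+ p.
  elim/ltn_ind: m i => m IH i; have [mp|pm] := ltnP m p.
    apply: prod_le_expn => //; first by move=> k; rewrite f0 fc.
    by rewrite addKn ltnW.
  rewrite (@big_cat_nat _ _ _ (i + p)%N) ?leq_addr ?leq_add2l//=.
  rewrite -[leRHS]mul1r; apply: ler_pM; rewrite ?block//; try exact: prodr_ge0.
  have -> : (i + m = i + p + (m - p))%N by rewrite -addnA subnKC.
  by apply: IH; rewrite ltn_subrL p_gt0 (leq_trans p_gt0 pm).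
move=> i j; have [ij|ji] := leqP i j; first by rewrite -(subnKC ij).
by rewrite big_geq ?(ltnW ji)// exprn_ege1.
Qed.

End PeriodicSequences.

Section ImpulseCounting.
Variables (R : realType) (omega : R) (p : nat) (tk : nat -> R).
Hypothesis tk_incr : forall k, tk k < tk k.+1.
Hypothesis tk_oo : tk k @[k --> \oo] --> +oo.
Hypothesis tk_per : forall k, tk (k + p)%N = tk k + omega.

(** [cnt t] is the number of impulses before [t].  The equivalence characterizes
it, and turns products over the impulses of an interval into products over
ranges of integers. *)
Lemma impulse_count_exists :
  exists cnt : R -> nat, forall t k, (tk k < t) = (k < cnt t)%N.
Proof.
have ex t : exists k, t <= tk k.
  by have [N _ /(_ N (leqnn N))] := (cvgryPge _).1 tk_oo t; exists N.
exists (fun t => ex_minn (ex t)) => t k.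
case: ex_minnP => m tm mmin; rewrite ltnNge; apply/idP/idP.
  move=> kt; apply/negP => mk.
  have /increasing_seqP tkm := tk_incr.
  have : tk m <= tk k by rewrite (tkm m k).
  by rewrite leNgt (lt_le_trans kt tm).
by apply: contraR; rewrite -leNgt => /mmin.
Qed.

Variable cnt : R -> nat.
Hypothesis cntP : forall t k, (tk k < t) = (k < cnt t)%N.

Lemma cnt_homo u t : u <= t -> (cnt u <= cnt t)%N.
Proof.
move=> ut; rewrite leqNgt -cntP; apply/negP => h.
by have := lt_le_trans h ut; rewrite cntP ltnn.
Qed.

Lemma tk_lt i j : (tk i < tk j) = (i < j)%N.
Proof.
have /increasing_seqP tkm := tk_incr.
by rewrite ltNge (tkm j i) -ltnNge.
Qed.

Lemma cnt_impulse k : cnt (tk k) = k.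
Proof.
apply/eqP; rewrite eqn_leq leqNgt -cntP ltxx/= leqNgt -tk_lt cntP ltnn.
by [].
Qed.

Lemma cnt_left s : \forall u \near s^'-, cnt u = cnt s.
Proof.
case E : (cnt s) => [|k].
  near=> u; apply/eqP; rewrite -leqn0 -E; apply: cnt_homo.
  by apply/ltW; near: u; exact: nbhs_left_lt.
have ks : tk k < s by rewrite cntP E.
near=> u; apply/eqP; rewrite eqn_leq -{1}E; apply/andP; split.
  by apply: cnt_homo; apply/ltW; near: u; exact: nbhs_left_lt.
by rewrite -cntP; near: u; exact: nbhs_left_gt.
Unshelve. all: by end_near. Qed.

Lemma cnt_right s : (forall k, s <> tk k) -> \forall u \near s^'+, cnt u = cnt s.
Proof.
move=> sk; have h : s < tk (cnt s).
  by rewrite lt_neqAle leNgt cntP ltnn andbT; exact/eqP.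
near=> u; apply/eqP; rewrite eqn_leq; apply/andP; split.
  rewrite leqNgt -cntP -leNgt; apply/ltW; near: u; exact: nbhs_right_lt.
by apply: cnt_homo; apply/ltW; near: u; exact: nbhs_right_gt.
Unshelve. all: by end_near. Qed.

Lemma cnt_right_impulse k : \forall u \near (tk k)^'+, cnt u = k.+1.
Proof.
near=> u; apply/eqP; rewrite eqn_leq; apply/andP; split.
  rewrite leqNgt -cntP -leNgt; apply/ltW; near: u; exact: nbhs_right_lt.
by rewrite -cntP; near: u; exact: nbhs_right_gt.
Unshelve. all: by end_near. Qed.

Lemma impulses_finite t :
  exists E : seq R, forall s, (exists k, s = tk k) -> s <= t -> s \in E.
Proof.
exists [seq tk k | k <- iota 0 (cnt (t + 1))] => s [k ->] kt.
apply: map_f; rewrite mem_iota add0n/= -cntP.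
by apply: le_lt_trans kt _; rewrite ltrDl.
Qed.

Lemma fsbig_impulses (F : nat -> R) u t :
  \big[*%R/1]_(k \in [set k | u <= tk k < t]) F k =
  \prod_(cnt u <= k < cnt t) F k.
Proof.
have -> : [set k | u <= tk k < t] = [set` index_iota (cnt u) (cnt t)].
  apply/seteqP; split => k /=; rewrite mem_index_iota cntP.
    by move=> /andP[uk ->]; rewrite andbT leqNgt -cntP ltNge uk.
  by move=> /andP[uk ->]; rewrite andbT leNgt cntP ltnNge uk.
by rewrite [RHS]fsbig_seq// iota_uniq.
Qed.

(** Shifting an index by [j * p] shifts the impulse time by [j] periods. *)
Lemma cnt_window u t j : t - u <= j%:R * omega -> (cnt t - cnt u <= j * p)%N.
Proof.
move=> tu; rewrite leq_subLR leqNgt -cntP -leNgt.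
have shift k i : tk (k + i * p)%N = tk k + i%:R * omega.
  elim: i => [|i IH]; first by rewrite mul0n addn0 mul0r addr0.
  by rewrite mulSn (addnC p) addnA tk_per IH -addrA -natr1 mulrDl mul1r.
rewrite shift; have : u <= tk (cnt u) by rewrite leNgt cntP ltnn.
by move: tu; lra.
Qed.

Variable bk : nat -> R.
Hypothesis bk_gt : forall k, -1 < bk k.
Let w k := (1 + bk k)^-1.

Lemma onebk_gt0 k : 0 < 1 + bk k.
Proof. by have := bk_gt k; lra. Qed.

Lemma invb_gt0 k : 0 < w k.
Proof. by rewrite invr_gt0 onebk_gt0. Qed.

Variable c : R.
Hypothesis c_ge1 : 1 <= c.
Hypothesis w_le : forall k, w k <= c.

Lemma Bmax_ge (taui : R -> R) s u : s - taui s <= u -> u <= s ->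
  \prod_(cnt u <= k < cnt s) w k <= Bmax tk bk taui s.
Proof.
move=> su us; apply: ub_le_sup.
  exists (c ^+ cnt s) => _ [th _ <-]; rewrite fsbig_impulses.
  by apply: prod_le_expn; rewrite ?leq_subr// => k; rewrite w_le ltW ?invb_gt0.
exists (u - s); first by rewrite /= in_itv/= subr_le0 us andbT; lra.
by rewrite fsbig_impulses addrC subrK.
Qed.

Lemma Bmax_le (taui : R -> R) s (r : R) j : 0 <= taui s -> taui s <= r ->
  r <= j%:R * omega -> Bmax tk bk taui s <= c ^+ (j * p).
Proof.
move=> t0 tr rj; apply: ge_sup.
  eexists; exists 0; last by [].
  by rewrite /= in_itv/= lexx andbT oppr_le0.
move=> _ [th /= + <-]; rewrite in_itv/= => /andP[h1 h2]; rewrite fsbig_impulses.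
apply: prod_le_expn => //; first by move=> k; rewrite w_le ltW ?invb_gt0.
by apply: cnt_window; lra.
Qed.

Lemma Bmax_ge1 (taui : R -> R) s : 0 <= taui s -> 1 <= Bmax tk bk taui s.
Proof.
move=> t0; have := @Bmax_ge taui s s; rewrite big_geq//; apply => //.
by rewrite gerBl.
Qed.

End ImpulseCounting.

(** * Removing the jumps from the difference of two solutions *)

(** On nonnegative arguments the slope of [expR (- be * x)] is at most [be] in
absolute value, whence the first bound; the second is the tangent inequality at
[v]. *)
Lemma expR_sub_bounds (R : realType) (be u v : R) : 0 < be -> 0 <= u -> 0 <= v ->
  expR (- be * u) - expR (- be * v) <= be * posp (- (u - v)) /\
  - (expR (- be * u) - expR (- be * v)) <= be * expR (- be * v) * posp (u - v).
Proof.
move=> be0 u0 v0.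
have key x y : 0 <= x -> x <= y ->
    0 <= expR (- be * x) - expR (- be * y) <= expR (- be * x) * (be * (y - x)).
  move=> x0 xy; rewrite subr_ge0 ler_expR !mulNr lerN2 ler_pM2l// xy/=.
  have -> : expR (- (be * y)) = expR (- (be * x)) * expR (- (be * (y - x))).
    by rewrite -expRD; congr expR; ring.
  rewrite -{1}[expR (- (be * x))]mulr1 -mulrBr ler_wpM2l ?expR_ge0//.
  by rewrite lerBlDr -lerBlDl; have := expR_ge1Dx (- (be * (y - x))); lra.
have [uv|/ltW vu] := leP u v.
  have /andP[k0 k1] := key u v u0 uv.
  rewrite [posp (u - v)]posp0 ?subr_le0// mulr0 oppr_le0 k0; split => //.
  rewrite posp_id; last by rewrite oppr_ge0 subr_le0.
  apply: (le_trans k1); rewrite opprB -[leRHS]mul1r ler_wpM2r//.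
    by rewrite mulr_ge0 ?subr_ge0// ltW.
  by rewrite -expR0 ler_expR mulNr oppr_le0 mulr_ge0// ltW.
have /andP[k0 k1] := key v u v0 vu.
rewrite [posp (- _)]posp0 ?oppr_le0 ?subr_ge0// mulr0 -oppr_ge0 opprB k0; split => //.
rewrite posp_id ?subr_ge0//; apply: (le_trans k1).
by rewrite mulrA (mulrC be).
Qed.

Section Model.
Variables (R : realType) (n : nat) (a A : R -> R) (b beta tau : 'I_n -> R -> R).
Variables (tk : nat -> R) (Imp : nat -> R -> R) (ak bk : nat -> R).
Variables (cnt : R -> nat) (r a0 t0 : R).
Hypothesis AD : forall s : R, -1 < s -> is_derive s 1 A (a s).
Hypothesis b_gt0 : forall i s, 0 < b i s.
Hypothesis beta_gt0 : forall i s, 0 < beta i s.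
Hypothesis tau_gt0 : forall i s, 0 < tau i s.
Hypothesis r_ge0 : 0 <= r.
Hypothesis tau_le : forall i s, tau i s <= r.
Hypothesis tk_incr : forall k, tk k < tk k.+1.
Hypothesis cntP : forall t k, (tk k < t) = (k < cnt t)%N.
Hypothesis Imp_pos : forall k u, 0 < u -> 0 < u + Imp k u.
Hypothesis bk_gt : forall k, -1 < bk k.
Hypothesis bk_le_ak : forall k, bk k <= ak k.
Hypothesis Imp_slope : forall k x y, 0 < x -> 0 < y -> x <> y ->
  bk k <= (Imp k x - Imp k y) / (x - y) <= ak k.
Hypothesis t0_ge0 : 0 <= t0.

Lemma left_derive_expA (f : R -> R) s dN : 0 <= s -> is_left_derive f s dN ->
  is_left_derive (fun u => f u * expR (A u)) s (expR (A s) * (dN + a s * f s)).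
Proof.
move=> s0 fs; have s1 : -1 < s by lra.
have -> : expR (A s) * (dN + a s * f s) = dN * expR (A s) + f s * (expR (A s) * a s).
  by ring.
apply: left_deriveM => //.
exact: (@is_derive1_comp _ expR A s _ _ (is_derive_expR _) (AD s1)).
Qed.

Section Positivity.
Variable N : R -> R.
Hypothesis N_sol : solution a b beta tau tk Imp t0 N.
Hypothesis N_t0 : 0 < N t0.

Lemma solution_continuous s : t0 < s -> (forall k, s <> tk k) ->
  N u @[u --> s] --> N s.
Proof.
case: N_sol => h1 h2 _ _ ts sk; apply/left_right_continuousP.
by split; [exact: h1|apply: h2 => //; exact: ltW].
Qed.

(** Without impulses in between, [N * expR A] is nondecreasing, since its left
derivative is a sum of exponentials with positive coefficients. *)
Lemma solution_pos_step (c s L : R) : t0 <= c -> c < s ->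
  (forall k, c < tk k -> s <= tk k) -> N u @[u --> c^'+] --> L -> 0 < L -> 0 < N s.
Proof.
move=> tc cs cks NL L0; have t00 := t0_ge0; have [h1 h2 h3 h4] := N_sol.
have Acont u : t0 <= u -> expR (A v) @[v --> u] --> expR (A u).
  move=> tu; apply: continuous_cvg; first exact: continuous_expR.
  apply/differentiable_continuous/derivable1_diffP.
  have u1 : -1 < u by lra.
  by case: (AD u1).
have noimp u : c < u -> u < s -> forall k, u <> tk k.
  by move=> cu us k uk; have := cks k; rewrite -uk => /(_ cu); rewrite leNgt us.
have mono u : c < u -> u < s -> N u * expR (A u) <= N s * expR (A s).
  move=> cu us; have tu := le_lt_trans tc cu.
  apply: (@left_derive_ndecr _ [::] (fun v => N v * expR (A v))); first exact: ltW.
    apply/continuous_within_itvP => //; split.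
    - move=> v; rewrite in_itv/= => /andP[uv vs]; apply: cvgM.
        apply: solution_continuous; first exact: lt_trans uv.
        by apply: noimp => //; exact: lt_trans uv.
      by apply: Acont; apply/ltW; exact: lt_trans uv.
    - apply: cvg_at_right_filter; apply: cvgM; last by apply: Acont; exact: ltW.
      by apply: solution_continuous => //; exact: noimp.
    - apply: cvgM; first by apply: h1; exact: lt_trans us.
      by apply: cvg_at_left_filter; apply: Acont; apply/ltW; exact: lt_trans us.
  move=> v /andP[uv vs] _; have tv := lt_trans tu uv.
  have [dN Nv dNE] := h3 v tv (noimp v (lt_trans cu uv) vs).
  exists (expR (A v) * (dN + a v * N v)).
    by apply: left_derive_expA => //; apply: le_trans t0_ge0 (ltW tv).
  rewrite dNE mulr_ge0 ?expR_ge0//; apply: sumr_ge0 => i _.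
  by rewrite mulr_ge0 ?expR_ge0// ltW.
have LA : L * expR (A c) <= N s * expR (A s).
  have lim : N u * expR (A u) @[u --> c^'+] --> L * expR (A c).
    by apply: cvgM => //; apply: cvg_at_right_filter; exact: Acont.
  apply: (cvgr_to_le lim); near=> u; apply: mono.
    by near: u; exact: nbhs_right_gt.
  by near: u; exact: nbhs_right_lt.
rewrite -(pmulr_lgt0 _ (expR_gt0 (A s))); apply: lt_le_trans LA.
by rewrite mulr_gt0// expR_gt0.
Unshelve. all: by end_near. Qed.

(** Induction on the number of impulses met since [t0]; an impulse keeps a
positive value positive. *)
Lemma solution_pos s : t0 <= s -> 0 < N s.
Proof.
have [h1 h2 h3 h4] := N_sol.
suff claim m u : t0 <= u -> (cnt u <= cnt t0 + m)%N -> 0 < N u.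
  by move=> ts; apply: (claim (cnt s)) => //; exact: leq_addl.
elim: m u => [|m IH] u tu um.
  move: tu; rewrite le_eqVlt => /predU1P[<- //|tu].
  have nok k : t0 <= tk k -> u <= tk k.
    rewrite !leNgt !cntP -!leqNgt => h; apply: leq_trans h.
    by rewrite addn0 in um.
  apply: (@solution_pos_step t0 u (N t0)) => //.
    by move=> k /ltW; exact: nok.
  apply: h2 => // k tkE; have := nok k; rewrite -tkE lexx => /(_ isT).
  by rewrite leNgt tu.
have [um'|um'] := leqP (cnt u) (cnt t0 + m); first exact: IH.
have uE : cnt u = (cnt t0 + m).+1 by apply/eqP; rewrite eqn_leq um' -addnS um.
set j := (cnt t0 + m)%N in um' uE.
have ju : tk j < u by rewrite cntP uE.
have tj : t0 <= tk j by rewrite leNgt cntP -leqNgt leq_addr.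
have Nj : 0 < N (tk j) by apply: IH => //; rewrite (cnt_impulse tk_incr cntP).
have [Np NpE NpI] := h4 j tj.
apply: (@solution_pos_step (tk j) u Np) => //.
  move=> k; rewrite (tk_lt tk_incr) => jk.
  by rewrite leNgt cntP uE ltnS -ltnNge.
have -> : Np = N (tk j) + Imp j (N (tk j)) by rewrite -NpI addrC subrK.
exact: Imp_pos.
Qed.

End Positivity.
Section Difference.
Variables (N M : R -> R).
Hypothesis N_sol : solution a b beta tau tk Imp t0 N.
Hypothesis M_sol : solution a b beta tau tk Imp t0 M.
Hypothesis N_t0 : 0 < N t0.
Hypothesis N_hist : forall s, t0 - r <= s -> s <= t0 -> 0 <= N s.
Hypothesis M_gt0 : forall s, t0 - r <= s -> 0 < M s.

(** The factor by which the impulse multiplies [N - M].  When the difference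
vanishes any factor will do, and [1 + bk k] keeps the bounds of
[jump_ratio_bounds].  Impulses before [t0] get the same default, since nothing
is known there about the signs of [N] and [M]. *)
Definition jump_ratio (k : nat) : R :=
  if (t0 <= tk k) && (N (tk k) != M (tk k)) then
    1 + (Imp k (N (tk k)) - Imp k (M (tk k))) / (N (tk k) - M (tk k))
  else 1 + bk k.

Definition jump_prod (s : R) : R := \prod_(cnt t0 <= k < cnt s) jump_ratio k.

Definition unjumped (s : R) : R := (N s - M s) / jump_prod s.

Lemma N_ge0 s : t0 - r <= s -> 0 <= N s.
Proof.
move=> ts; have [st|/ltW st] := leP s t0; first exact: N_hist.
by apply: ltW; exact: solution_pos.
Qed.

Lemma M_gt0_after s : t0 <= s -> 0 < M s.
Proof. by move=> ts; apply: M_gt0; apply: le_trans ts; rewrite gerBl. Qed.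

Lemma jump_ratio_bounds k : 1 + bk k <= jump_ratio k <= 1 + ak k.
Proof.
rewrite /jump_ratio; case: ifPn => [/andP[tk0 NM]|_]; last by rewrite lexx lerD2l/=.
rewrite !lerD2l; apply: Imp_slope; last exact/eqP.
- exact: (solution_pos N_sol N_t0).
- exact: M_gt0_after.
Qed.

Lemma jump_ratio_gt0 k : 0 < jump_ratio k.
Proof.
have /andP[h _] := jump_ratio_bounds k; apply: lt_le_trans h.
exact: onebk_gt0.
Qed.

Lemma jump_prod_gt0 s : 0 < jump_prod s.
Proof. by apply: prodr_gt0 => k _; exact: jump_ratio_gt0. Qed.

Lemma jump_prod_hist s : s <= t0 -> jump_prod s = 1.
Proof. by move=> st; rewrite /jump_prod big_geq//; exact: cnt_homo. Qed.

Lemma unjumped_hist s : s <= t0 -> unjumped s = N s - M s.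
Proof. by move=> st; rewrite /unjumped jump_prod_hist// divr1. Qed.

Lemma jump_prod_left s : \forall u \near s^'-, jump_prod u = jump_prod s.
Proof. by apply: filterS (cnt_left cntP s) => u; rewrite /jump_prod => ->. Qed.

Lemma cvg_unjumped_left s : t0 < s -> unjumped u @[u --> s^'-] --> unjumped s.
Proof.
have [N1 _ _ _] := N_sol; have [M1 _ _ _] := M_sol => ts.
have : (N u - M u) / jump_prod s @[u --> s^'-] --> unjumped s.
  by apply: cvgMl; apply: cvgB; [exact: N1|exact: M1].
apply: cvg_trans; apply: near_eq_cvg.
by apply: filterS (jump_prod_left s) => u; rewrite /unjumped => ->.
Qed.

(** At an impulse the product acquires the factor [jump_ratio k], which is exactly
the factor acquired by [N - M]. *)
Lemma cvg_unjumped_right s : t0 <= s -> unjumped u @[u --> s^'+] --> unjumped s.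
Proof.
have [_ N2 _ N4] := N_sol; have [_ M2 _ M4] := M_sol => ts.
have [[k sk]|nk] := pselect (exists k, s = tk k); last first.
  have sk k : s <> tk k by move=> sk; apply: nk; exists k.
  have : (N u - M u) / jump_prod s @[u --> s^'+] --> unjumped s.
    by apply: cvgMl; apply: cvgB; [exact: N2|exact: M2].
  apply: cvg_trans; apply: near_eq_cvg.
  by apply: filterS (cnt_right cntP sk) => u uE; rewrite /unjumped /jump_prod uE.
rewrite sk in ts *.
have [Np Nlim NE] := N4 k ts; have [Mp Mlim ME] := M4 k ts.
have tk_k : (cnt t0 <= k)%N by rewrite leqNgt -cntP -leNgt.
pose Pk := jump_prod (tk k) * jump_ratio k.
have yE : (Np - Mp) / Pk = unjumped (tk k).
  rewrite /unjumped /Pk; have P0 := jump_prod_gt0 (tk k).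
  have J0 := jump_ratio_gt0 k.
  have -> : Np - Mp = (N (tk k) - M (tk k)) * jump_ratio k.
    have -> : Np - Mp = (N (tk k) - M (tk k)) + (Imp k (N (tk k)) - Imp k (M (tk k))).
      by rewrite -NE -ME; ring.
    rewrite /jump_ratio ts/=; case: eqVneq => [->|NM /=]; first by rewrite !subrr mul0r addr0.
    by rewrite mulrDr mulr1 mulrC divfK// subr_eq0.
  by rewrite -mulrA invfM (mulrCA (jump_ratio k)) divff ?gt_eqF// mulr1.
rewrite -yE.
have : (N u - M u) / Pk @[u --> (tk k)^'+] --> (Np - Mp) / Pk.
  by apply: cvgMl; exact: cvgB.
apply: cvg_trans; apply: near_eq_cvg.
apply: filterS (cnt_right_impulse tk_incr cntP k) => u uE.
rewrite /unjumped /jump_prod uE big_nat_recr//= /Pk /jump_prod.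
by rewrite (cnt_impulse tk_incr cntP).
Qed.

(** The ratio is the inverse of the product of the jump ratios met from [u] to
[s], of which those before [t0] are missing.  So the product belongs to a window
that may be shorter than the delay, which the maximum in [Bmax] allows. *)
Lemma jump_prod_ratio (taui : R -> R) c s u : 1 <= c -> 
  (forall k, (1 + bk k)^-1 <= c) ->
  t0 <= s -> 0 <= taui s -> s - taui s <= u -> u <= s ->
  jump_prod u / jump_prod s <= Bmax tk bk taui s.
Proof.
move=> c1 wc ts t0s su us.
pose v := Num.max u t0.
have vs : v <= s by rewrite ge_max us.
have uv : jump_prod u = jump_prod v.
  rewrite /v; case: (leP u t0) => // ut.
  by rewrite !jump_prod_hist.
have Bv := @Bmax_ge R tk cnt cntP bk bk_gt c c1 wc taui s v _ vs.
apply: le_trans (Bv _); last by rewrite (le_trans su)// le_max lexx.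
have tv : (cnt t0 <= cnt v)%N by apply: cnt_homo => //; rewrite le_max lexx orbT.
rewrite uv /jump_prod [X in _ / X](big_cat_nat tv (cnt_homo cntP vs))/=.
have J0 : 0 < \prod_(cnt t0 <= k < cnt v) jump_ratio k.
  by apply: prodr_gt0 => k _; exact: jump_ratio_gt0.
rewrite invfM mulrA divff ?gt_eqF// mul1r -prodfV.
apply: ler_prod => k _; rewrite invr_ge0 (ltW (jump_ratio_gt0 k))/=.
rewrite lef_pV2 ?posrE ?jump_ratio_gt0 ?onebk_gt0//.
by case/andP: (jump_ratio_bounds k).
Qed.

Lemma norm_le_unjumped C s :
  (forall i j, \prod_(i <= k < j) (1 + ak k) <= C) ->
  `|N s - M s| <= C * `|unjumped s|.
Proof.
move=> HC; have P0 := jump_prod_gt0 s.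
have PC : jump_prod s <= C.
  apply: le_trans (HC (cnt t0) (cnt s)); apply: ler_prod => k _.
  by rewrite ltW ?jump_ratio_gt0//=; case/andP: (jump_ratio_bounds k).
have -> : N s - M s = jump_prod s * unjumped s.
  by rewrite /unjumped mulrC divfK// gt_eqF.
by rewrite normrM (gtr0_norm P0) ler_wpM2r.
Qed.

Definition up_coef i s := beta i s * b i s * Bmax tk bk (tau i) s.

Definition down_coef i s :=
  beta i s * b i s * expR (- beta i s * M (s - tau i s)) * Bmax tk bk (tau i) s.

Definition unjumped_slope s :=
  (jump_prod s)^-1 * (expR (A s) * \sum_i b i s *
    (expR (- beta i s * N (s - tau i s)) - expR (- beta i s * M (s - tau i s)))).

Lemma left_derive_unjumped s : t0 < s -> (forall k, s <> tk k) ->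
  is_left_derive (fun u => unjumped u * expR (A u)) s (unjumped_slope s).
Proof.
have [_ _ N3 _] := N_sol; have [_ _ M3 _] := M_sol => ts sk.
have [dN Ns NE] := N3 s ts sk; have [dM Ms ME] := M3 s ts sk.
have s0 : 0 <= s by apply: le_trans t0_ge0 (ltW ts).
apply: (@left_derive_eq_near _ (fun u => (jump_prod s)^-1 *
    (N u * expR (A u) + -1 * (M u * expR (A u))))).
- apply: filterS (jump_prod_left s) => u uE.
  by rewrite /unjumped uE; ring.
- by rewrite /unjumped; ring.
rewrite /unjumped_slope; apply: left_deriveZ.
have -> : \sum_i b i s * (expR (- beta i s * N (s - tau i s)) -
      expR (- beta i s * M (s - tau i s))) =
    (dN + a s * N s) - (dM + a s * M s).
  by rewrite NE ME -sumrB; apply: eq_bigr => i _; rewrite mulrBr.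
rewrite mulrBr -[X in _ - X]mul1r -mulNr.
by apply: left_deriveD; [|apply: left_deriveZ]; exact: left_derive_expA.
Qed.

(** The delayed difference is the delayed product times the delayed [unjumped];
dividing by the current product leaves the factor bounded by [jump_prod_ratio]. *)
Lemma unjumped_delay_ineq c : 1 <= c -> (forall k, (1 + bk k)^-1 <= c) ->
  delay_ineq A tau [set s | exists k, s = tk k] t0 up_coef down_coef
    unjumped unjumped_slope.
Proof.
move=> c1 wc.
have ratio i s : t0 < s ->
    jump_prod (s - tau i s) / jump_prod s <= Bmax tk bk (tau i) s.
  move=> ts; apply: (@jump_prod_ratio _ c) => //; try exact: ltW.
  by rewrite gerBl ltW.
have scale i s (e : R) : t0 < s -> 0 <= e ->
    (jump_prod s)^-1 * (e * posp (N (s - tau i s) - M (s - tau i s))) <=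
      e * Bmax tk bk (tau i) s * posp (unjumped (s - tau i s)) /\
    (jump_prod s)^-1 * (e * posp (- (N (s - tau i s) - M (s - tau i s)))) <=
      e * Bmax tk bk (tau i) s * posp (- unjumped (s - tau i s)).
  move=> ts e0; set x := N _ - M _.
  have P0 := jump_prod_gt0 (s - tau i s).
  have xE : x = jump_prod (s - tau i s) * unjumped (s - tau i s).
    by rewrite /unjumped mulrC divfK// gt_eqF.
  have pospM y : posp (jump_prod (s - tau i s) * y) = jump_prod (s - tau i s) * posp y.
    by rewrite /posp maxr_pMr ?mulr0// ltW.
  rewrite xE -mulrN !pospM; split.
    rewrite [leLHS](_ : _ = e * (jump_prod (s - tau i s) / jump_prod s) * posp (unjumped (s - tau i s))); last by ring.
    by rewrite ler_wpM2r ?posp_ge0// ler_wpM2l// ratio.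
  rewrite [leLHS](_ : _ = e * (jump_prod (s - tau i s) / jump_prod s) * posp (- unjumped (s - tau i s))); last by ring.
  by rewrite ler_wpM2r ?posp_ge0// ler_wpM2l// ratio.
have arg i s : t0 < s -> t0 - r <= s - tau i s.
  by move=> ts; apply: lerB; [exact: ltW|exact: tau_le].
split.
- by apply: cvg_unjumped_right.
- move=> s ts; apply/left_right_continuousP; split; first exact: cvg_unjumped_left.
  by apply: cvg_unjumped_right; exact: ltW.
- move=> s ts sk; apply: left_derive_unjumped => // k skE; apply: sk.
  by exists k.
- move=> s ts _; rewrite /unjumped_slope mulrCA ler_pM2l ?expR_gt0// mulr_sumr.
  apply: ler_sum => i _.
  have [up _] := expR_sub_bounds (beta_gt0 i s) (N_ge0 (arg i s ts)) (ltW (M_gt0 (arg i s ts))).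
  have bb : 0 <= beta i s * b i s by rewrite mulr_ge0// ltW.
  have [_ sc] := scale i s _ ts bb; apply: le_trans sc.
  rewrite ler_pM2l ?invr_gt0 ?jump_prod_gt0// -mulrA mulrCA.
  by rewrite ler_pM2l.
- move=> s ts _; rewrite /unjumped_slope; set S := \sum_i _.
  rewrite (_ : - _ = expR (A s) * ((jump_prod s)^-1 * - S)); last by ring.
  rewrite ler_pM2l ?expR_gt0// /S -sumrN mulr_sumr.
  apply: ler_sum => i _.
  have [_ dn] := expR_sub_bounds (beta_gt0 i s) (N_ge0 (arg i s ts)) (ltW (M_gt0 (arg i s ts))).
  have bb : 0 <= beta i s * b i s * expR (- beta i s * M (s - tau i s)).
    by rewrite !mulr_ge0 ?expR_ge0// ltW.
  have [sc _] := scale i s _ ts bb; apply: le_trans sc.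
  rewrite ler_pM2l ?invr_gt0 ?jump_prod_gt0// -mulrN.
  rewrite [leRHS](_ : _ = b i s * (beta i s * expR (- beta i s * M (s - tau i s))
    * posp (N (s - tau i s) - M (s - tau i s)))); last by ring.
  by rewrite ler_pM2l.
Qed.

End Difference.
End Model.

(** * Periodic functions and the integral constants *)

Lemma periodic_continuous_extrema (R : realType) (omega : R) (f : R -> R) :
  0 < omega -> continuous f -> (forall s, f (s + omega) = f s) ->
  exists m M, forall s, f m <= f s <= f M.
Proof.
move=> w0 fc fp.
have fn (j : nat) s : f (s + j%:R * omega) = f s.
  elim: j => [|j IH]; first by rewrite mul0r addr0.
  by rewrite -natr1 mulrDl mul1r addrA fp IH.
have fz (z : int) s : f (s + z%:~R * omega) = f s.
  case: z => j; first exact: fn.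
  by rewrite NegzE mulrNz mulNr -(fn j.+1 (s - _)) subrK.
have red s : exists2 u, u \in `[0, omega] & f u = f s.
  exists (s + (- Num.floor (s / omega))%:~R * omega); last exact: fz.
  have /andP[h1 h2] := Num.Theory.floor_itv (s / omega).
  rewrite in_itv/= mulrNz mulNr subr_ge0 -ler_pdivlMr// h1/=.
  move: h2; rewrite intrD1 ltr_pdivrMr// mulrDl mul1r => /ltW.
  by rewrite lerBlDr addrC.
have c0 := continuous_subspaceT (A := `[0, omega]) fc.
have [m _ mP] := EVT_min (ltW w0) c0; have [M _ MP] := EVT_max (ltW w0) c0.
by exists m, M => s; have [u ui <-] := red s; rewrite mP// MP.
Qed.

Lemma solution_later (R : realType) (n : nat) (a : R -> R)
    (b beta tau : 'I_n -> R -> R) tk Imp (t0 t1 : R) N : t0 <= t1 ->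
  solution a b beta tau tk Imp t0 N -> solution a b beta tau tk Imp t1 N.
Proof.
move=> tt [h1 h2 h3 h4]; split.
- by move=> s ts; apply: h1; exact: le_lt_trans ts.
- by move=> s ts; apply: h2; exact: le_trans ts.
- by move=> s ts; apply: h3; exact: le_lt_trans ts.
- by move=> k tk1; apply: h4; exact: le_trans tk1.
Qed.

Section Alpha.
Variables (R : realType) (n : nat) (a A : R -> R) (tau : 'I_n -> R -> R).
Variables (r K T : R) (co : 'I_n -> R -> R).
Hypothesis a_cont : continuous a.
Hypothesis a_ge0 : forall s, 0 <= a s.
Hypothesis AD : forall s : R, -1 < s -> is_derive s 1 A (a s).
Hypothesis tau_le : forall i s, tau i s <= r.
Hypothesis r_ge0 : 0 <= r.
Hypothesis rT : r < T.
Hypothesis co_ge0 : forall i s, 0 <= co i s.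
Hypothesis coK : forall s, 0 <= s -> \sum_i co i s <= K.

Let window (t : R) : \bar R :=
  (\int[@lebesgue_measure R]_(s in `[(t - tau_max tau t)%R, t])
     ((\sum_(i < n) co i s *
        expR (- \int[@lebesgue_measure R]_(u in `[s, t]) a u))%R)%:E)%E.

Lemma expR_primitive s t : 0 <= s -> s <= t ->
  expR (- \int[@lebesgue_measure R]_(u in `[s, t]) a u) = expR (A s - A t).
Proof.
move=> s0 st; have s1 : -1 < s by lra.
by rewrite /Rintegral (integral_primitive a_cont AD s1 st) /= opprB.
Qed.

Lemma windowE t : T <= t -> window t =
  (\int[@lebesgue_measure R]_(s in `[(t - tau_max tau t)%R, t])
     ((\sum_(i < n) co i s * expR (A s - A t))%R)%:E)%E.
Proof.
move=> Tt; apply: eq_integral => s; rewrite inE /= in_itv/= => /andP[ts st].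
have tm : tau_max tau t <= r by exact: tau_max_le.
have rT' := rT.
congr EFin; apply: eq_bigr => i _; rewrite expR_primitive//; lra.
Qed.

(** The coefficients have bounded sum and the windows bounded length, so the
supremum is finite; this is what excludes an infinite alpha2 compensated by a
vanishing alpha1. *)
Lemma window_sup_real : exists alpha : R,
  [/\ 0 <= alpha, ereal_sup [set window t | t in [set t | T <= t]] = alpha%:E &
   forall c, T <= c -> (\int[@lebesgue_measure R]_(s in `[(c - tau_max tau c)%R, c])
     ((\sum_(i < n) co i s * expR (A s - A c))%R)%:E <= alpha%:E)%E].
Proof.
set al := ereal_sup _.
have rT' := rT; have r0 := r_ge0.
have K0 : 0 <= K by apply: le_trans (coK (lexx 0)); exact: sumr_ge0.
have win_le t : T <= t -> (window t <= al)%E.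
  by move=> Tt; apply: ereal_sup_ubound; exists t.
have al0 : (0 <= al)%E.
  apply: le_trans (win_le T (lexx T)); apply: integral_ge0 => s _.
  by rewrite lee_fin; apply: sumr_ge0 => i _; rewrite mulr_ge0 ?expR_ge0.
have alK : (al <= (K * r)%:E)%E.
  apply: ge_ereal_sup => _ [t /= Tt <-]; rewrite windowE//.
  have tm : tau_max tau t <= r by exact: tau_max_le.
  have tm0 : 0 <= tau_max tau t by rewrite /tau_max bigmax_ge_id.
  apply: (@le_trans _ _ (\int[@lebesgue_measure R]_(s in `[(t - tau_max tau t)%R, t]) (cst K%:E s))%E).
    apply: le_lower_integral => //.
    move=> s; rewrite /= in_itv/= => /andP[ts st]; rewrite !lee_fin.
    rewrite sumr_ge0/=; last by move=> i _; rewrite mulr_ge0 ?expR_ge0.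
    have s0 : 0 <= s by lra.
    apply: le_trans (coK s0); apply: ler_sum => i _.
    rewrite ler_piMr// -expR_primitive// -expR0 ler_expR oppr_le0.
    by apply: Rintegral_ge0 => u _; exact: a_ge0.
  rewrite integral_cst//= lebesgue_measure_itv/= lte_fin.
  case: ifPn => _; last by rewrite mule0 lee_fin mulr_ge0.
  by rewrite -EFinD -EFinM lee_fin ler_wpM2l// opprB addrC subrK.
have alfin : al \is a fin_num.
  by rewrite ge0_fin_numE//; apply: le_lt_trans alK _; rewrite ltry.
exists (fine al); rewrite fineK//; split => //; first exact: fine_ge0.
by move=> c Tc; rewrite -windowE// win_le.
Qed.

End Alpha.

(** * Global asymptotic stability *)

Theorem theorem3p1 (R : realType) (omega : R) (n p : nat)
  (a : R -> R) (b beta tau : 'I_n -> R -> R)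
  (tk : nat -> R) (Imp : nat -> R -> R) (ak bk : nat -> R) (Nst : R -> R)
  (omega_gt0 : 0 < omega) (n_gt0 : (0 < n)%N) (p_gt0 : (0 < p)%N)
  (ha : pos_periodic_cont omega a)
  (hb : forall i, pos_periodic_cont omega (b i))
  (hbeta : forall i, pos_periodic_cont omega (beta i))
  (htau : forall i, pos_periodic_cont omega (tau i))
  (htau_mono : forall i, {homo (fun s => s - tau i s) : x y / x <= y})
  (tk0_gt0 : 0 < tk 0%N)
  (tk_incr : forall k, tk k < tk k.+1)
  (tk_oo : tk k @[k --> \oo] --> +oo)
  (tk_per : forall k, tk (k + p)%N = tk k + omega)
  (tk_p : forall k, (tk k <= omega) = (k < p)%N)
  (Imp_cont : forall k, {within `[0, +oo[, continuous (Imp k)})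
  (Imp_pos : forall k u, 0 < u -> 0 < u + Imp k u)
  (Imp_per : forall k u, 0 < u -> Imp (k + p)%N u = Imp k u)
  (ak_per : forall k, ak (k + p)%N = ak k)
  (bk_per : forall k, bk (k + p)%N = bk k)
  (bk_gt : forall k, (k < p)%N -> -1 < bk k)
  (Imp_slope : forall k x y, (k < p)%N -> 0 <= x -> 0 <= y -> x <> y ->
     bk k <= (Imp k x - Imp k y) / (x - y) <= ak k)
  (prod_ak : \prod_(k < p) (1 + ak k) <= 1)
  (hNst : positive_periodic_solution omega a b beta tau tk Imp Nst)
  (hT : exists2 T : R, tau_bar tau < T &
     (alpha1 a b beta tau tk bk Nst T * alpha2 a b beta tau tk bk T < 1)%E) :
  globally_asymptotically_stable a b beta tau tk Imp Nst.
Proof.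
have [T rT hA] := hT; set r := tau_bar tau in rT.
have a_pos s : 0 < a s by case: ha => _ + _; apply.
have b_pos i s : 0 < b i s by case: (hb i) => _ + _; apply.
have beta_pos i s : 0 < beta i s by case: (hbeta i) => _ + _; apply.
have tau_pos i s : 0 < tau i s by case: (htau i) => _ + _; apply.
have a_cont : continuous a by case: ha.
have tau_cont i : continuous (tau i) by case: (htau i).
have [m [m2 a_ext]] := periodic_continuous_extrema omega_gt0 a_cont
  (let: And3 _ _ h := ha in h).
have a_ge s : a m <= a s by case/andP: (a_ext s).
(* The base point is negative, so that [A] is differentiable at time 0 too. *)
have [A AD] := exists_primitive (-1) a_cont.
have tau_ub i : exists t, forall s, tau i s <= t.
  have [m3 [M HM]] := periodic_continuous_extrema omega_gt0 (tau_cont i)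
    (let: And3 _ _ h := htau i in h).
  by exists (tau i M) => s; case/andP: (HM s).
have [tb tbP] := choice tau_ub.
have tau_le i s : tau i s <= r.
  apply: le_trans (le_tau_max tau i s) _.
  apply: ub_le_sup; last by exists s.
  exists (\big[Num.max/0]_(j < n) tb j) => _ [u _ <-].
  apply: bigmax_le; first exact: bigmax_ge_id.
  by move=> j _; apply: le_trans (tbP j u) _; exact: le_bigmax.
have r_ge0 : 0 <= r.
  by apply: le_trans (tau_le (Ordinal n_gt0) 0); exact: ltW.
have [cnt cntP] := impulse_count_exists tk_incr tk_oo.
have bk_all k : -1 < bk k.
  by rewrite (periodic_modn bk_per); apply: bk_gt; exact: ltn_pmod.
have slope_all k x y : 0 < x -> 0 < y -> x <> y ->
    bk k <= (Imp k x - Imp k y) / (x - y) <= ak k.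
  move=> x0 y0 xy; rewrite (periodic_modn bk_per) (periodic_modn ak_per).
  rewrite (@periodic_modn p _ (fun k => Imp k x)); last by move=> j; exact: Imp_per.
  rewrite (@periodic_modn p _ (fun k => Imp k y)); last by move=> j; exact: Imp_per.
  by apply: Imp_slope; rewrite ?ltn_pmod// ltW.
have bk_ak k : bk k <= ak k.
  have /andP[h1 h2] : bk k <= (Imp k 2 - Imp k 1) / (2 - 1) <= ak k.
    by apply: slope_all => //; apply/eqP; rewrite gt_eqF// ltr1n.
  exact: le_trans h1 h2.
have [c c1 wc] : exists2 c, 1 <= c & forall k, (1 + bk k)^-1 <= c.
  by apply: (periodic_bounded p_gt0) => k; rewrite bk_per.
have [C C0 HC] : exists2 C, 0 < C & forall i j, \prod_(i <= k < j) (1 + ak k) <= C.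
  apply: (prod_periodic_bounded p_gt0) => //; first by move=> k; rewrite ak_per.
  by move=> k; have := bk_all k; have := bk_ak k; lra.
have [j rj] : exists j : nat, r <= j%:R * omega.
  (* a number of periods that covers the largest delay *)
  exists (Num.truncn (r / omega)).+1; rewrite -ler_pdivrMr//.
  by apply/ltW/truncnS_gt.
have bb_ub i : exists t, forall s, beta i s * b i s <= t.
  have [bc _ bp] := hb i; have [bec _ bep] := hbeta i.
  have [||m3 [M HM]] := @periodic_continuous_extrema R omega (fun s => beta i s * b i s) omega_gt0.
  - by move=> s; apply: cvgM; [exact: bec|exact: bc].
  - by move=> s; rewrite bp bep.
  by exists (beta i M * b i M) => s; case/andP: (HM s).
have [bbm bbmP] := choice bb_ub.
pose up := up_coef b beta tau tk bk.
pose down := down_coef b beta tau tk bk Nst.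
have B_ge0 i s : 0 <= Bmax tk bk (tau i) s.
  apply: le_trans ler01 _; apply: (Bmax_ge1 cntP bk_all c1 wc); exact: ltW.
have up_ge0 i s : 0 <= up i s.
  by rewrite /up /up_coef !mulr_ge0// ltW.
have down_ge0 i s : 0 <= down i s.
  by rewrite /down /down_coef !mulr_ge0 ?expR_ge0// ltW.
pose K := \sum_i bbm i * c ^+ (j * p).
have upK s : \sum_i up i s <= K.
  apply: ler_sum => i _; apply: ler_pM => //; first by rewrite mulr_ge0// ltW.
  apply: (Bmax_le tk_per cntP bk_all c1 wc (ltW (tau_pos i s)) (tau_le i s) rj).
have [Nst_sol Nst_gt0 Nst_per] := hNst.
have downK s : 0 <= s -> \sum_i down i s <= K.
  move=> s0; apply: le_trans (upK s); apply: ler_sum => i _.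
  rewrite /down /up /down_coef /up_coef; apply: ler_wpM2r => //.
  rewrite ler_piMr ?mulr_ge0 ?(ltW (beta_pos _ _)) ?(ltW (b_pos _ _))//.
  rewrite -expR0 ler_expR mulNr oppr_le0 mulr_ge0 ?(ltW (beta_pos _ _))//.
  by apply/ltW/Nst_gt0; have := tau_le i s; rewrite -/r; lra.
have K_ge0 : 0 <= K by apply: le_trans (upK 0); exact: sumr_ge0.
have a_ge0 s : 0 <= a s by exact: ltW.
(* alpha2 and alpha1 unfold to the suprema over windows for [up] and [down] *)
have [A2 [A2_ge0 A2E A2P]] := window_sup_real a_cont a_ge0 AD tau_le r_ge0 rT
  up_ge0 (fun s _ => upK s).
have [A1 [A1_ge0 A1E A1P]] := window_sup_real a_cont a_ge0 AD tau_le r_ge0 rT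
  down_ge0 downK.
have A12 : A1 * A2 < 1.
  by rewrite -lte_fin EFinM -A1E -A2E.
have [w [q [w0 q01 A2w A1w]]] := weight_exists A1_ge0 A2_ge0 A12.
have Jfin := impulses_finite cntP.
(* Stability uses this from every [t0], attractivity from 0. *)
have core t0 N : 0 <= t0 -> solution a b beta tau tk Imp t0 N -> 0 < N t0 ->
    (forall s, t0 - r <= s -> s <= t0 -> 0 <= N s) ->
    delay_ineq A tau [set s | exists k, s = tk k] t0 up down
      (unjumped tk Imp bk cnt t0 N Nst)
      (unjumped_slope A b beta tau tk Imp bk cnt t0 N Nst) /\
    forall s, `|N s - Nst s| <= C * `|unjumped tk Imp bk cnt t0 N Nst s|.
  move=> t00 Nsol N0 Nhist; have Msol := solution_later t00 Nst_sol.
  have M0 s : t0 - r <= s -> 0 < Nst s.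
    by move=> ts; apply: Nst_gt0; apply: le_trans ts; rewrite -/r; lra.
  split.
    exact: (unjumped_delay_ineq AD b_pos beta_pos tau_pos r_ge0 tau_le tk_incr
      cntP Imp_pos bk_all bk_ak slope_all t00 Nsol Msol N0 Nhist M0 c1 wc).
  move=> s; exact: (norm_le_unjumped AD b_pos r_ge0 tk_incr cntP Imp_pos bk_all
    bk_ak slope_all t00 Nsol N0 M0 s HC).
split.
(* The windows are controlled from [S0] on; [G] carries the Gronwall growth of
   the history bound up to [S0 + r] and the change of norms, [C] the jumps. *)
- move=> eps t0 eps0 t00; pose S0 := Num.max T t0.
  pose G := Num.max w 1 * (Num.max w^-1 1 * expR (K * (S0 + r - t0))).
  have max1 (u : R) : 0 < Num.max u 1 by rewrite lt_max ltr01 orbT.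
  have G0 : 0 < G by rewrite /G; do 2 (apply: mulr_gt0; first exact: max1); exact: expR_gt0.
  have CG0 : 0 < 2 * (C * G) by apply: mulr_gt0; [rewrite ltr0n|exact: mulr_gt0].
  exists (eps / (2 * (C * G))); first exact: divr_gt0.
  move=> N Nsol [_ _ Nhist N0] Hsup s ts; rewrite addr0 in N0.
  have Nh u : t0 - r <= u -> u <= t0 -> 0 <= N u.
    move=> tu ut; have := Nhist (u - t0); rewrite (addrC t0) subrK; apply.
    by rewrite -/r; lra.
  have [zD zN] := core t0 N t00 Nsol N0 Nh.
  have tS0 : t0 <= S0 by rewrite le_max lexx orbT.
  have TS0 : T <= S0 by rewrite le_max lexx.
  have AD' u : t0 <= u -> is_derive u 1 A (a u) by move=> tu; apply: AD; lra.
  have hist u : t0 - r <= u -> u <= t0 ->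
      `|unjumped tk Imp bk cnt t0 N Nst u| < eps / (2 * (C * G)).
    move=> tu ut; rewrite (unjumped_hist _ _ cntP _ _ ut) -lte_fin.
    apply: le_lt_trans Hsup; apply: ereal_sup_ubound; exists (u - t0).
      by rewrite /= in_itv/= -/r; lra.
    by rewrite (addrC t0) subrK.
  have := delay_ineq_stable AD' (a_pos m) a_ge tau_pos tau_le r_ge0 tau_cont
    htau_mono Jfin K_ge0 zD up_ge0 down_ge0 (fun s _ => upK s)
    (fun s ts => downK s (le_trans t00 ts)) tS0
    (fun c Sc => A2P c (le_trans TS0 Sc)) (fun c Sc => A1P c (le_trans TS0 Sc))
    w0 q01 A2w A1w (divr_gt0 eps0 CG0) hist ts.
  move=> bnd; apply: le_lt_trans (zN s) _.
  apply: le_lt_trans (ler_wpM2l (ltW C0) bnd) _.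
  have dE : eps / (2 * (C * G)) * (C * G) = eps / 2.
    by rewrite invfM (mulrA eps) divfK// mulf_neq0// gt_eqF.
  move: dE; set d := eps / (2 * (C * G)) => dE.
  rewrite [X in X < _](_ : _ = d * (C * G)); last by rewrite /G; ring.
  by rewrite dE; lra.
- move=> N [Nsol _ Nhist N0].
  have Nh u : 0 - r <= u -> u <= 0 -> 0 <= N u.
    by move=> tu ut; apply: Nhist; rewrite -/r ut andbT; lra.
  have [zD zN] := core 0 N (lexx _) Nsol N0 Nh.
  have T0 : 0 <= T by lra.
  have T1 : 0 + r <= T by lra.
  have AD' (u : R) : 0 <= u -> is_derive u 1 A (a u) by move=> tu; apply: AD; lra.
  have van := delay_ineq_vanishes AD' (a_pos m) a_ge tau_pos tau_le r_ge0 tau_cont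
    htau_mono Jfin K_ge0 zD up_ge0 down_ge0 (fun s _ => upK s) downK T0 A2P A1P
    w0 q01 A2w A1w T1.
  apply/cvgrPdist_le => e e0.
  have [T' HT'] := van (e / C) (divr_gt0 e0 C0).
  near=> s; rewrite sub0r normrN; apply: le_trans (zN s) _.
  rewrite mulrC -ler_pdivlMr//; apply: HT'.
  by near: s; apply: nbhs_pinfty_ge; exact: num_real.
Unshelve. all: by end_near. Qed.
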